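(* Let $E$ be a vector bundle with connection $A$ over the sphere $S^4$ (with its standard round metric, orientation and spin structure), and suppose that $A$ is a solution of the Yang--Mills equations $d_A\ast F_A=0$ which is not self-dual. Let $F_A^-\in\Omega^2(S^4,\operatorname{End}E)$ be the anti-self-dual component of its curvature, and let $\psi\in C^\infty(S^-)$ be a solution of the twistor equation $D\psi=0$. Then $F_A^-\cdot\psi\in C^\infty(S^-\otimes\operatorname{End}E)$ satisfies the coupled Dirac equation $${\not\!\!D}_A(F_A^-\cdot\psi)=0 .$$
   Context: For a vector bundle $E$ with connection $A$ on an oriented Riemannian 4-manifold $M$, $d_A:\Omega^p(M,E)\to\Omega^{p+1}(M,E)$ is the exterior covariant derivative and $F_A=d_A^2\in\Omega^2(M,\operatorname{End}E)$ is the curvature. The Hodge star satisfies $\ast^2=1$ on 2-forms, so $\Lambda^2T^*=\Lambda^2_+\oplus\Lambda^2_-$ (the $\pm1$ eigenspaces of $\ast$) and $F_A=F_A^++F_A^-$ accordingly; $A$ is self-dual if $F_A^-=0$. The connection $A$ induces a connection on $\operatorname{End}E$. When $M$ is spin, $S=S^+\oplus S^-$ is the complex spinor bundle with the connection $\nabla$ induced by the Levi-Civita connection, and Clifford multiplication maps $T^*\otimes S^+\to S^-$ and $T^*\otimes S^-\to S^+$. It is normalized by $e_i\cdot e_j+e_j\cdot e_i=-2\delta_{ij}$ for a local orthonormal basis $e_1,\dots,e_4$ of 1-forms with volume form $e_1\wedge e_2\wedge e_3\wedge e_4$. A 2-form acts on spinors by Clifford multiplication, $e_i\wedge e_j$ ($i\neq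 j$) acting as $e_i\cdot e_j$; the convention for $S^\pm$ is that self-dual 2-forms act trivially on $S^-$ and anti-self-dual 2-forms act trivially on $S^+$. For an $\operatorname{End}E$-valued 2-form $F$ and a spinor $\psi$, $F\cdot\psi$ is the resulting $\operatorname{End}E$-valued spinor. The Dirac operator is ${\not\!\!D}\psi=\sum_i e_i\cdot\nabla_i\psi$. The coupled Dirac operator ${\not\!\!D}_A$ on $S\otimes\operatorname{End}E$ is defined by the same formula using the tensor product of $\nabla$ with the connection on $\operatorname{End}E$ induced by $A$. The twistor operator $D:C^\infty(S)\to C^\infty(T^*\otimes S)$ is $\nabla$ followed by orthogonal projection onto the kernel of Clifford multiplication $T^*\otimes S\to S$: $$D\psi=\sum_{i=1}^4\left(e_i\otimes\nabla_i\psi+\tfrac14 e_i\otimes e_i\cdot{\not\!\!D}\psi\right).$$ *)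

(* Defs.v *)
From HB Require Import structures.
From mathcomp Require Import all_boot all_order all_algebra.
From mathcomp Require Import complex.
From mathcomp Require Import all_classical all_reals all_analysis.
From mathcomp Require Import ring lra.
Set Implicit Arguments.
Unset Strict Implicit.
Unset Printing Implicit Defensive.
Import Order.TTheory GRing.Theory Num.Theory.
Import numFieldNormedType.Exports.
Local Open Scope classical_set_scope.
Local Open Scope complex_scope.
Local Open Scope ring_scope.

Section Calculus.
Variable R : realType.
Implicit Types (U : set 'rV[R]_4) (x v : 'rV[R]_4).

Definition ebase (k : 'I_4) : 'rV[R]_4 := delta_mx 0 k.

Fixpoint Ck (n : nat) U (f : 'rV[R]_4 -> R) : Prop :=
  match n with
  | 0 => forall x, U x -> {for x, continuous f}
  | n'.+1 => (forall x, U x -> differentiable f x) /\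
             (forall k, Ck n' U (fun x => 'D_(ebase k) f x))
  end.

Definition smooth U (f : 'rV[R]_4 -> R) : Prop := forall n, Ck n U f.

Definition smooth_mx m n U (f : 'rV[R]_4 -> 'M[R[i]]_(m, n)) : Prop :=
  forall a b, smooth U (fun x => complex.Re (f x a b)) /\
              smooth U (fun x => complex.Im (f x a b)).

(* [R[i]] is not a normed module over [R] in the library, hence the split into
   real and imaginary parts. *)
Definition dirC v (f : 'rV[R]_4 -> R[i]) x : R[i] :=
  'D_v (fun z => complex.Re (f z)) x +i* 'D_v (fun z => complex.Im (f z)) x.

Definition dir m n v (f : 'rV[R]_4 -> 'M[R[i]]_(m, n)) x : 'M[R[i]]_(m, n) :=
  \matrix_(a, b) dirC v (fun z => f z a b) x.

Definition partial m n (k : 'I_4) (f : 'rV[R]_4 -> 'M[R[i]]_(m, n)) x :=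
  dir (ebase k) f x.

End Calculus.

Section Sphere.
Variable R : realType.
Implicit Types (c : bool) (x u v : 'rV[R]_4).

Definition sqnorm n (x : 'rV[R]_n) : R := \sum_k x 0 k ^+ 2.

Definition sphere4 : set 'rV[R]_5 := [set p | sqnorm p = 1].

Definition flip c x : 'rV[R]_4 :=
  \row_k (if c && (k == 0) then - x 0 k else x 0 k).

(* Inverse stereographic projections: from the south pole for [false], from the
   north pole for [true].  The reflection in the second one makes the change of
   coordinates orientation preserving; both then carry the orientation of S^4
   as the boundary of the ball. *)
Definition stereo c x : 'rV[R]_5 :=
  (1 + sqnorm x)^-1 *:
  (row_mx (2 *: flip c x)
     (if c then sqnorm x - 1 else 1 - sqnorm x)%:M : 'rV[R]_(4 + 1)).

(* The change of coordinates, in either direction, on x != 0. *)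
Definition trans x : 'rV[R]_4 := (sqnorm x)^-1 *: flip true x.

Definition jac x (l k : 'I_4) : R := 'D_(ebase R k) (fun z => trans z 0 l) x.

Definition round_metric c x u v : R :=
  \sum_(a < 5) 'D_u (fun z => stereo c z 0 a) x * 'D_v (fun z => stereo c z 0 a) x.

(* An oriented orthonormal frame of the round metric, in both charts. *)
Definition frame (k : 'I_4) x : 'rV[R]_4 := ((1 + sqnorm x) / 2) *: ebase R k.

Definition coframe c x (k : 'I_4) v : R := round_metric c x v (frame k x).

Definition lie_bracket (V W : 'rV[R]_4 -> 'rV[R]_4) x : 'rV[R]_4 :=
  \row_m ('D_(V x) (fun z => W z 0 m) x - 'D_(W x) (fun z => V z 0 m) x).

(* <nabla_{e_i} e_j, e_k> for the Levi-Civita connection: the Koszul formula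
   in an orthonormal frame. *)
Definition levi_civita c x (i j k : 'I_4) : R :=
  2^-1 * (round_metric c x (lie_bracket (frame i) (frame j) x) (frame k x)
        - round_metric c x (lie_bracket (frame j) (frame k) x) (frame i x)
        + round_metric c x (lie_bracket (frame k) (frame i) x) (frame j x)).

(* Matrix of the change of frame: the differential of [trans] sends e_k at x to
   sum_l L_lk e_l at [trans x]. *)
Definition frame_trans x (l k : 'I_4) : R :=
  coframe true (trans x) l (\row_m (\sum_n jac x m n * frame k x 0 n)).

End Sphere.

Section SphereFacts.
Variable R : realType.

Lemma stereo_sphere4 c (x : 'rV[R]_4) : sphere4 (stereo c x).
Proof.
have p : 1 + sqnorm x != 0.
  by rewrite gt_eqF// ltr_pwDl// sumr_ge0// => k _; rewrite sqr_ge0.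
rewrite /sphere4 /= {1}/sqnorm /stereo.
have -> : \sum_(k < 5) ((1 + sqnorm x)^-1 *: (row_mx (2 *: flip c x)
     (if c then sqnorm x - 1 else 1 - sqnorm x)%:M : 'rV[R]_(4 + 1))) 0 k ^+ 2
  = \sum_(k < 4 + 1) (1 + sqnorm x)^-2 * (row_mx (2 *: flip c x)
     (if c then sqnorm x - 1 else 1 - sqnorm x)%:M) 0 k ^+ 2.
  by apply: eq_bigr => k _; rewrite mxE exprMn exprVn.
rewrite -big_distrr /= big_split_ord /= big_ord1 row_mxEr mxE eqxx mulr1n.
rewrite (eq_bigr (fun k => 4 * x 0 k ^+ 2)); last first.
  by move=> k _; rewrite row_mxEl !mxE; case: ifP => _; ring.
rewrite -big_distrr /= -/(sqnorm x).
by case: c; field.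
Qed.

Lemma sqnorm_eq0 n (x : 'rV[R]_n) : (sqnorm x == 0) = (x == 0).
Proof.
apply/eqP/eqP => [h|->]; last by rewrite /sqnorm big1// => k _; rewrite mxE expr0n.
apply/rowP => k; rewrite mxE; apply/eqP; rewrite -sqrf_eq0.
by move: h => /psumr_eq0P -> // i _; rewrite sqr_ge0.
Qed.

Lemma sqnorm_trans (x : 'rV[R]_4) : x != 0 -> sqnorm (trans x) = (sqnorm x)^-1.
Proof.
rewrite -sqnorm_eq0 => h; rewrite {1}/sqnorm (eq_bigr (fun k => (sqnorm x)^-2 * x 0 k ^+ 2)).
  by rewrite -big_distrr /= -/(sqnorm x); field.
by move=> k _; rewrite !mxE; case: ifP => _; field.
Qed.

Lemma stereo_trans (x : 'rV[R]_4) : x != 0 -> stereo true (trans x) = stereo false x.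
Proof.
move=> h; have q : 0 < sqnorm x.
  by rewrite lt_def sqnorm_eq0 h/= sumr_ge0// => k _; rewrite sqr_ge0.
have p : 1 + sqnorm x != 0 by rewrite gt_eqF ?addr_gt0.
have p' : 1 + (sqnorm x)^-1 != 0 by rewrite gt_eqF ?addr_gt0 ?invr_gt0.
rewrite /stereo sqnorm_trans// !scale_row_mx.
apply: (f_equal2 (@row_mx R 1 4 1)).
  apply/rowP => k; rewrite !mxE /=.
  have q0 : sqnorm x != 0 by rewrite gt_eqF.
  by case: (k == 0); field; rewrite ?[_ + 1]addrC p q0.
by apply/rowP => k; rewrite !ord1 !mxE eqxx !mulr1n; field; rewrite ?[_ + 1]addrC p gt_eqF.
Qed.

Lemma is_derive_coord (x u : 'rV[R]_4) k : is_derive x u (fun z : 'rV[R]_4 => z 0 k) (u 0 k).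
Proof.
have h t : t != 0 -> t^-1 *: ((t *: u + x) 0 k - x 0 k) = u 0 k.
  by move=> t0; rewrite !mxE addrK scalerA mulVf// scale1r.
have l : ((fun t => t^-1 *: (((fun z : 'rV[R]_4 => z 0 k) \o shift x) (t *: u) - x 0 k)) @ 0^' --> u 0 k)%classic.
  apply: cvg_near_cst; near=> t; apply: h.
  near: t; exact: nbhs_dnbhs_neq.
by split; [apply/cvg_ex; exists (u 0 k) | apply: cvg_lim].
Unshelve. all: by end_near. Qed.

Definition dot (x u : 'rV[R]_4) : R := \sum_k x 0 k * u 0 k.

Lemma is_derive_sqnorm (x u : 'rV[R]_4) : is_derive x u (@sqnorm R 4) (2 * dot x u).
Proof.
have -> : @sqnorm R 4 = \sum_(k < 4) (fun z : 'rV[R]_4 => z 0 k) ^+ 2.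
  by apply/funext => z; rewrite fct_sumE.
rewrite /dot big_distrr /=.
have -> : \sum_(i < 4) 2 * (x 0 i * u 0 i) = \sum_(i < 4) (2%:R * x 0 i ^+ 1) *: u 0 i.
  by apply: eq_bigr => i _; rewrite /GRing.scale /= expr1 mulrA.
by apply: is_derive_sum => i; apply: is_deriveX; apply: is_derive_coord.
Qed.

Lemma is_derive_stereo c (x u : 'rV[R]_4) (p : 'rV[R]_4 -> R) dp (a : 'I_5) :
  (forall z, stereo c z 0 a = (1 + sqnorm z)^-1 * p z) -> is_derive x u p dp ->
  'D_u (fun z => stereo c z 0 a) x =
   (1 + sqnorm x)^-1 * dp - (1 + sqnorm x)^-2 * (2 * dot x u) * p x.
Proof.
move=> hp dpP.
have nz : 1 + sqnorm x != 0.
  by rewrite gt_eqF// ltr_pwDl// sumr_ge0// => k _; rewrite sqr_ge0.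
have -> : (fun z => stereo c z 0 a) = (fun z => (1 + sqnorm z)^-1) * p.
  by apply/funext => z; rewrite hp.
have d1 : is_derive x u (fun z : 'rV[R]_4 => 1 + sqnorm z) (0 + 2 * dot x u).
  exact: (is_deriveD (is_derive_cst (1 : R) x u) (is_derive_sqnorm x u)).
have d2 : is_derive x u (fun z : 'rV[R]_4 => (1 + sqnorm z)^-1)
    (- (1 + sqnorm x) ^- 2 *: (2 * dot x u)).
  split; first by apply: derivableV => //; exact: ex_derive.
  by rewrite deriveV// ?derive_val ?add0r//; exact: ex_derive.
have d3 := is_deriveM d2 dpP.
rewrite derive_val /GRing.scale /=; ring.
Qed.

Lemma round_metricE c (x u v : 'rV[R]_4) :
  round_metric c x u v = (2 / (1 + sqnorm x)) ^+ 2 * \sum_k u 0 k * v 0 k.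
Proof.
have nz : 1 + sqnorm x != 0.
  by rewrite gt_eqF// ltr_pwDl// sumr_ge0// => k _; rewrite sqr_ge0.
pose s (k : 'I_4) : R := if c && (k == 0) then -1 else 1.
pose e : R := if c then -1 else 1.
have s2 k : s k ^+ 2 = 1 by rewrite /s; case: ifP; rewrite ?sqrrN expr1n.
have e2 : e ^+ 2 = 1 by rewrite /e; case: ifP; rewrite ?sqrrN expr1n.
have Dl w (k : 'I_4) : 'D_w (fun z => stereo c z 0 (lshift 1 k)) x =
   s k * ((1 + sqnorm x)^-1 * (2 * w 0 k) - (1 + sqnorm x)^-2 * (2 * dot x w) * (2 * x 0 k)).
  have hp z : stereo c z 0 (lshift 1 k) = (1 + sqnorm z)^-1 * (2 * s k * z 0 k).
    by rewrite /stereo mxE row_mxEl !mxE /s; case: ifP => _; ring.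
  have hd := is_deriveZ (2 * s k) (is_derive_coord x w k).
  by rewrite (@is_derive_stereo _ _ _ _ _ _ hp hd) /GRing.scale /=; ring.
have Dr w : 'D_w (fun z => stereo c z 0 (rshift 4 0)) x =
   - e * ((1 + sqnorm x)^-1 * (2 * dot x w) + (1 + sqnorm x)^-2 * (2 * dot x w) * (1 - sqnorm x)).
  have hp z : stereo c z 0 (rshift 4 0) = (1 + sqnorm z)^-1 * (e * (1 - sqnorm z)).
    by rewrite /stereo mxE row_mxEr !mxE /e mulr1n; case: ifP => _; ring.
  have hd := is_deriveZ e (is_deriveB (is_derive_cst (1 : R) x w) (is_derive_sqnorm x w)).
  by rewrite (@is_derive_stereo _ _ _ _ _ _ hp hd) /GRing.scale /=; ring.
pose q := sqnorm x.
have E (k : 'I_4) : 'D_u (fun z => stereo c z 0 (lshift 1 k)) x *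
           'D_v (fun z => stereo c z 0 (lshift 1 k)) x =
    4 / (1 + q) ^+ 2 * (u 0 k * v 0 k)
    + (- 8 * dot x u / (1 + q) ^+ 3) * (x 0 k * v 0 k)
    + (- 8 * dot x v / (1 + q) ^+ 3) * (x 0 k * u 0 k)
    + (16 * dot x u * dot x v / (1 + q) ^+ 4) * x 0 k ^+ 2.
  by rewrite !Dl mulrACA -expr2 s2 -/q; field.
rewrite /round_metric (@big_split_ord _ _ _ 4 1) /= big_ord1 !Dr.
under eq_bigr => k _ do rewrite E.
rewrite [- e * _ * _]mulrACA -expr2 sqrrN e2 mul1r.
rewrite !big_split /= -!big_distrr /= -/(dot x u) -/(dot x v) -/(sqnorm x) -/q.
field.
exact: nz.
Qed.

Lemma frame_orthonormal c (x : 'rV[R]_4) j k :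
  round_metric c x (frame j x) (frame k x) = (j == k)%:R.
Proof.
have nz : 1 + sqnorm x != 0.
  by rewrite gt_eqF// ltr_pwDl// sumr_ge0// => i _; rewrite sqr_ge0.
rewrite round_metricE (bigD1 k)//= big1; last first.
  by move=> i /negPf ik; rewrite !mxE ik mulr0 mulr0.
by rewrite !mxE !eqxx eq_sym /=; case: eqP => _; field.
Qed.

End SphereFacts.

Section Spinors.
Variable R : realType.
Local Notation C := R[i].
Implicit Types (c : bool) (x : 'rV[R]_4).

Definition clifford (gamma : 'I_4 -> 'M[C]_4) : Prop :=
  forall i j, gamma i *m gamma j + gamma j *m gamma i = (- 2 *+ (i == j))%:M.

Definition cliff_vec (gamma : 'I_4 -> 'M[C]_4) (v : 'rV[R]_4) : 'M[C]_4 :=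
  \sum_k (v 0 k)%:C *: gamma k.

Definition Spin4 (gamma : 'I_4 -> 'M[C]_4) : set 'M[C]_4 :=
  [set h | exists s : seq 'rV[R]_4,
     [/\ forall v, v \in s -> sqnorm v = 1, ~~ odd (size s)
       & h = \prod_(v <- s) cliff_vec gamma v]].

(* The spin structure is a lift [sp_trans] to Spin(4) of the change of frame
   between the two charts; it is unique up to sign, S^4 being simply connected.
   S is associated to it by the complex representation [sp_gamma] of the
   Clifford algebra on C^4, which is unique up to isomorphism. *)
Record spinor_bundle := SpinorBundle {
  sp_gamma : 'I_4 -> 'M[C]_4;
  sp_trans : 'rV[R]_4 -> 'M[C]_4;
  sp_clifford : clifford sp_gamma;
  sp_smooth : smooth_mx [set x | x != 0] sp_trans;
  sp_spin : forall x, x != 0 -> Spin4 sp_gamma (sp_trans x);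
  sp_lift : forall x k, x != 0 ->
    sp_trans x *m sp_gamma k =
    (\sum_l (frame_trans x l k)%:C *: sp_gamma l) *m sp_trans x }.

Variable S : spinor_bundle.
Local Notation gamma := (sp_gamma S).

(* e_1.e_2.e_3.e_4 ; it is 1 on S^- and -1 on S^+ (see
   [selfdual_act_Sminus]). *)
Definition vol : 'M[C]_4 := gamma 0 *m gamma 1 *m gamma 2 *m gamma 3.

Definition in_Sminus (s : 'cV[C]_4) : Prop := vol *m s = s.

Definition spinor_section (psi : bool -> 'rV[R]_4 -> 'cV[C]_4) : Prop :=
  (forall c, smooth_mx setT (psi c)) /\
  (forall x, x != 0 -> psi true (trans x) = sp_trans S x *m psi false x).

Definition spin_conn c x (i : 'I_4) : 'M[C]_4 :=
  \sum_j \sum_k (4^-1 * levi_civita c x i j k)%:C *: (gamma j *m gamma k).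

Definition nabla c (i : 'I_4) (psi : 'rV[R]_4 -> 'cV[C]_4) x : 'cV[C]_4 :=
  dir (frame i x) psi x + spin_conn c x i *m psi x.

Definition dirac c (psi : 'rV[R]_4 -> 'cV[C]_4) x : 'cV[C]_4 :=
  \sum_i gamma i *m nabla c i psi x.

(* The component along e_i of the twistor operator. *)
Definition twistor c (psi : 'rV[R]_4 -> 'cV[C]_4) x (i : 'I_4) : 'cV[C]_4 :=
  nabla c i psi x + 4^-1 *: (gamma i *m dirac c psi x).

End Spinors.

Section SpinorFacts.
Variables (R : realType) (S : spinor_bundle R).
Local Notation gamma := (sp_gamma S).

Lemma gammaC i j : i != j -> gamma i *m gamma j = - (gamma j *m gamma i).
Proof.
move=> /negPf ij; apply/eqP; rewrite -addr_eq0 sp_clifford ij mulr0n.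
by apply/eqP/matrixP => a b; rewrite !mxE mul0rn.
Qed.

Lemma gammaK i : gamma i *m gamma i = -1%:M.
Proof.
have := sp_clifford S i i; rewrite eqxx mulr1n -[X in X = _]mulr2n => h.
have /eqP : (gamma i *m gamma i + 1%:M) *+ 2 = 0.
  rewrite mulrnDl h; apply/matrixP => a b; rewrite !mxE.
  by case: (a == b); rewrite ?mulr1n ?mulr0n ?mul0rn ?addr0// addNr.
rewrite -scaler_nat scaler_eq0 pnatr_eq0 /= addr_eq0 => /eqP ->; by [].
Qed.

(* A basis of the self-dual 2-forms acts trivially on S^-. *)
Lemma selfdual_act_Sminus s : in_Sminus S s ->
  [/\ (gamma 0 *m gamma 1 + gamma 2 *m gamma 3) *m s = 0,
      (gamma 0 *m gamma 2 + gamma 3 *m gamma 1) *m s = 0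
    & (gamma 0 *m gamma 3 + gamma 1 *m gamma 2) *m s = 0].
Proof.
move=> hs.
have E M N : N = - (M *m vol S) -> (M + N) *m s = 0.
  by move=> ->; rewrite mulmxDl mulNmx -mulmxA hs subrr.
have gK i (M : 'M[R[i]]_4) : gamma i *m (gamma i *m M) = - M.
  by rewrite mulmxA gammaK mulNmx mul1mx.
have gC i j (M : 'M[R[i]]_4) : i != j -> gamma i *m (gamma j *m M) = - (gamma j *m (gamma i *m M)).
  by move=> ij; rewrite mulmxA gammaC// mulNmx mulmxA.
split; apply: E; rewrite /vol -!mulmxA.
- by rewrite (gC 1 0)// mulmxN gK gK !opprK.
- by rewrite (gC 2 0)// mulmxN gK opprK (gC 2 1)// gK mulmxN opprK gammaC.
- rewrite (gC 3 0)// mulmxN gK opprK (gC 3 1)// (gC 3 2)// gammaK.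
  by rewrite !mulmxN !opprK mulmx1.
Qed.

Lemma lie_bracketC (V W : 'rV[R]_4 -> 'rV[R]_4) x : lie_bracket V W x = - lie_bracket W V x.
Proof. by apply/rowP => m; rewrite !mxE opprB. Qed.

(* The spin connection is compatible with the Levi-Civita connection. *)
Lemma spin_connP c x i m :
  spin_conn S c x i *m gamma m - gamma m *m spin_conn S c x i =
  \sum_k (levi_civita c x i m k)%:C *: gamma k.
Proof.
have lcA j k : levi_civita c x i j k = - levi_civita c x i k j.
  rewrite /levi_civita !round_metricE.
  rewrite [lie_bracket (frame k) (frame j) x]lie_bracketC
          [lie_bracket (frame j) (frame i) x]lie_bracketC
          [lie_bracket (frame i) (frame k) x]lie_bracketC.
  have N (u v : 'rV[R]_4) : \sum_k (- u) 0 k * v 0 k = - \sum_k u 0 k * v 0 k.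
    by rewrite -sumrN; apply: eq_bigr => t _; rewrite mxE mulNr.
  by rewrite !N; ring.
have comm j k : gamma j *m gamma k *m gamma m - gamma m *m (gamma j *m gamma k) =
    2%:R *: ((j == m)%:R *: gamma k - (k == m)%:R *: gamma j).
  have h1 a : gamma a *m gamma m = (- 2%:R * (a == m)%:R) *: 1%:M - gamma m *m gamma a.
    apply/eqP; rewrite eq_sym subr_eq sp_clifford; apply/eqP.
    by rewrite scale_scalar_mx mulr1 mulr_natr.
  rewrite -mulmxA (h1 k) mulmxBr -scalemxAr mulmx1 !mulmxA (h1 j) mulmxBl -scalemxAl mul1mx.
  rewrite scalerBr !scalerA opprB !mulNr !scaleNr.
  by rewrite opprK addrCA addrAC subrr add0r addrC.
rewrite /spin_conn mulmx_suml mulmx_sumr -sumrB.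
transitivity (\sum_j \sum_k ((4^-1 * levi_civita c x i j k)%:C * 2%:R) *:
    ((j == m)%:R *: gamma k - (k == m)%:R *: gamma j)).
  apply: eq_bigr => j _; rewrite mulmx_suml mulmx_sumr -sumrB; apply: eq_bigr => k _.
  by rewrite -scalemxAl -scalemxAr -scalerBr comm scalerA.
have -> : \sum_j \sum_k ((4^-1 * levi_civita c x i j k)%:C * 2%:R) *:
    ((j == m)%:R *: gamma k - (k == m)%:R *: gamma j) =
  \sum_k ((4^-1 * levi_civita c x i m k)%:C * 2%:R) *: gamma k
  - \sum_j ((4^-1 * levi_civita c x i j m)%:C * 2%:R) *: gamma j.
  under eq_bigr => j _ do
    (under eq_bigr => k _ do rewrite scalerBr !scalerA; rewrite sumrB).
  rewrite sumrB; congr (_ - _).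
    rewrite (bigD1 m)//= [X in _ + X]big1 ?addr0 => [|j /negPf jm].
      by apply: eq_bigr => k _; rewrite eqxx mulr1.
    by rewrite big1// => k _; rewrite jm mulr0 scale0r.
  apply: eq_bigr => j _; rewrite (bigD1 m)//= [X in _ + X]big1 ?addr0 => [|k /negPf km].
    by rewrite eqxx mulr1.
  by rewrite km mulr0 scale0r.
rewrite -sumrB; apply: eq_bigr => k _; rewrite -scalerBl [levi_civita c x i k m]lcA.
congr (_ *: _).
have -> : 2%:R = (2%:R : R)%:C by rewrite rmorph_nat.
by rewrite -!rmorphM -rmorphB; congr (_%:C); field.
Qed.

End SpinorFacts.

Section Bundles.
Variables (R : realType) (r : nat).
Local Notation C := R[i].
Implicit Types (c : bool) (x : 'rV[R]_4).

(* The complex vector bundle of rank r glued from trivial bundles on the open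
   sets [vb_dom i] of S^4 (traces of open sets of R^5): frame coordinates s_i,
   s_j of a section are related by s_i = g_ij s_j. A real bundle is covered by
   taking real [vb_trans]: then S (x) End E is the same as for its
   complexification. *)
Record vector_bundle := VectorBundle {
  vb_idx : Type;
  vb_dom : vb_idx -> set 'rV[R]_5;
  vb_trans : vb_idx -> vb_idx -> 'rV[R]_5 -> 'M[C]_r;
  vb_open : forall i, open (vb_dom i);
  vb_cover : forall p, sphere4 p -> exists i, vb_dom i p;
  vb_trans_id : forall i p, sphere4 p -> vb_dom i p -> vb_trans i i p = 1%:M;
  vb_cocycle : forall i j k p, sphere4 p ->
    vb_dom i p -> vb_dom j p -> vb_dom k p ->
    vb_trans i j p *m vb_trans j k p = vb_trans i k p;
  vb_smooth : forall i j c,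
    smooth_mx [set x | vb_dom i (stereo c x) /\ vb_dom j (stereo c x)]
              (fun x => vb_trans i j (stereo c x)) }.

Definition dom (E : vector_bundle) (i : vb_idx E) c : set 'rV[R]_4 :=
  [set x | vb_dom i (stereo c x)].

(* Matrix-valued forms on R^4, by their components on the coordinate fields. *)
Definition form1 := 'rV[R]_4 -> 'I_4 -> 'M[C]_r.
Definition form2 := 'rV[R]_4 -> 'I_4 -> 'I_4 -> 'M[C]_r.
Definition form3 := 'rV[R]_4 -> 'I_4 -> 'I_4 -> 'I_4 -> 'M[C]_r.

(* In the frame over [vb_dom i], d_A = d + [cn_form i c] in the chart c. *)
Record connection (E : vector_bundle) := Connection {
  cn_form : vb_idx E -> bool -> form1;
  cn_smooth : forall i c k, smooth_mx (dom i c) (fun x => cn_form i c x k);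
  cn_gauge : forall i j c x k, dom i c x -> dom j c x ->
    let g := fun z => vb_trans i j (stereo c z) in
    let g' := fun z => vb_trans j i (stereo c z) in
    cn_form j c x k = g' x *m cn_form i c x k *m g x + g' x *m partial k g x;
  cn_coord : forall i x k, x != 0 -> dom i false x ->
    cn_form i false x k =
    \sum_l (jac x l k)%:C *: cn_form i true (trans x) l }.

(* d_A on r-tuples of sections, and on r-tuples of E-valued 1-forms. *)
Definition dA0 (a : form1) (s : 'rV[R]_4 -> 'M[C]_r) : form1 :=
  fun x k => partial k s x + a x k *m s x.

Definition dA1 (a : form1) (b : form1) : form2 := fun x k l =>
  (partial k (fun z => b z l) x + a x k *m b x l) -
  (partial l (fun z => b z k) x + a x l *m b x k).

(* The curvature is d_A^2, here applied to the r sections of the local frame. *)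
Definition curvature (a : form1) : form2 := dA1 a (dA0 a (fun=> 1%:M)).

(* d_A on End E-valued 2-forms. *)
Definition dA2_End (a : form1) (b : form2) : form3 := fun x k l m =>
  let D k l m := partial k (fun z => b z l m) x
                 + (a x k *m b x l m - b x l m *m a x k) in
  D k l m + D l m k + D m k l.

(* Components of a 2-form on the orthonormal frame. *)
Definition on_frame (b : form2) : form2 := fun x k l =>
  \sum_m \sum_n (frame k x 0 m * frame l x 0 n)%:C *: b x m n.

Definition levi_symbol (i j k l : 'I_4) : R :=
  \det (\matrix_(a < 4) ebase R (tnth [tuple i; j; k; l] a)).

Definition star_frame (b : 'I_4 -> 'I_4 -> 'M[C]_r) : 'I_4 -> 'I_4 -> 'M[C]_r :=
  fun i j => \sum_k \sum_l (2^-1 * levi_symbol i j k l)%:C *: b k l.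

Definition star c (b : form2) : form2 := fun x m n =>
  \sum_k \sum_l (coframe c x k (ebase R m) * coframe c x l (ebase R n))%:C *:
    star_frame (on_frame b x) k l.

Definition asd_part c (b : form2) : form2 := fun x k l =>
  2^-1 *: (b x k l - star c b x k l).

Variables (E : vector_bundle) (A : connection E).

Definition Fminus (i : vb_idx E) c : form2 := asd_part c (curvature (cn_form A i c)).

Definition yang_mills : Prop := forall i c x k l m, dom i c x ->
  dA2_End (cn_form A i c) (star c (curvature (cn_form A i c))) x k l m = 0.

Definition self_dual : Prop := forall i c x k l, dom i c x ->
  Fminus i c x k l = 0.

(* An element of S (x) End E, by its four End E-valued spinor components. *)
Definition end_spinor := 'I_4 -> 'M[C]_r.

Definition act_spin (M : 'M[C]_4) (Psi : end_spinor) : end_spinor :=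
  fun a => \sum_b M a b *: Psi b.

Variable S : spinor_bundle R.

Definition end_spinor_section (Psi : vb_idx E -> bool -> 'rV[R]_4 -> end_spinor) :
    Prop :=
  [/\ forall i c a, smooth_mx (dom i c) (fun x => Psi i c x a),
      forall i j c x a, dom i c x -> dom j c x ->
        Psi j c x a =
        vb_trans j i (stereo c x) *m Psi i c x a *m vb_trans i j (stereo c x)
    & forall i x a, x != 0 -> dom i false x ->
        Psi i true (trans x) a = act_spin (sp_trans S x) (Psi i false x) a].

Definition in_Sminus_End (Psi : end_spinor) : Prop :=
  forall a, act_spin (vol S) Psi a = Psi a.

(* F . s for a 2-form F = sum_(k < l) F_kl e_k /\ e_l and a spinor s. *)
Definition cliff2 (b : 'I_4 -> 'I_4 -> 'M[C]_r) (s : 'cV[C]_4) : end_spinor :=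
  fun a => \sum_(k < 4) \sum_(l < 4 | (k < l)%N)
    (sp_gamma S k *m sp_gamma S l *m s) a 0 *: b k l.

Definition Fminus_act (psi : bool -> 'rV[R]_4 -> 'cV[C]_4) :
    vb_idx E -> bool -> 'rV[R]_4 -> end_spinor :=
  fun i c x => cliff2 (on_frame (Fminus i c) x) (psi c x).

Definition nabla_A (i : vb_idx E) c (k : 'I_4) (Psi : 'rV[R]_4 -> end_spinor) x :
    end_spinor :=
  let Ak := \sum_m (frame k x 0 m)%:C *: cn_form A i c x m in
  fun a => dir (frame k x) (fun z => Psi z a) x
           + act_spin (spin_conn S c x k) (Psi x) a
           + (Ak *m Psi x a - Psi x a *m Ak).

Definition dirac_A (i : vb_idx E) c (Psi : 'rV[R]_4 -> end_spinor) x : end_spinor :=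
  fun a => \sum_k act_spin (sp_gamma S k) (nabla_A i c k Psi x) a.

End Bundles.

(* Main.v *)
Require Import Defs.
From HB Require Import structures.
From mathcomp Require Import all_boot all_order all_algebra.
From mathcomp Require Import perm complex.
From mathcomp Require Import all_classical all_reals all_analysis.
From mathcomp Require Import ring lra.
Set Implicit Arguments.
Unset Strict Implicit.
Unset Printing Implicit Defensive.
Import Order.TTheory GRing.Theory Num.Theory.
Import numFieldNormedType.Exports.
Local Open Scope classical_set_scope.
Local Open Scope complex_scope.
Local Open Scope ring_scope.

(** The proof rests on two remarks that remove most of the geometry.

    First, a self-dual 2-form acts trivially on S^-, so for psi in S^- one has
    F^- . psi = F . psi with the whole curvature F ([asd_cliff2]). Hence the
    section property of F^- . psi only requires that F transforms as an
    End E-valued 2-form ([curvature_gauge], [curvature_pullback]), and the Hodge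
    star enters only through the Yang-Mills equation.

    Second, everything is conformally flat. In a stereographic chart the round
    orthonormal frame is e_k = rho d/dx_k with rho = (1 + |x|^2)/2, and the star
    on 2-forms is the flat one ([starE]), so the Yang-Mills equation says that
    the flat divergence of F vanishes ([yang_mills_divergence]), while the
    Bianchi identity is insensitive to the metric ([bianchi]). Write
    F . psi = 1/2 sum_kl F_kl (x) (dx_k /\ dx_l) . psi, where dx_k /\ dx_l acts
    as rho^2 e_k . e_l. The Leibniz rule splits the coupled Dirac operator of
    this sum into two parts, which vanish separately.

    - The Dirac operator applied to (dx_k /\ dx_l) . psi is zero
      ([dirac_coord_2form]). The twistor equation says that nabla_i psi = e_i . phi
      for a spinor phi, so the derivative of psi contributes
      sum_i e_i . e_k . e_l . e_i . phi, which is zero in dimension 4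
      ([gamma_sandwich]). What remains are the derivative of the weight rho^2
      and the commutator of the spin connection with e_k . e_l, namely
      2 x . e_k . e_l and -2 x . e_k . e_l ([spin_conn_commutator]).
    - The covariant derivatives of F contribute a multiple of
      sum_ikl e_i . e_k . e_l . psi (x) D_i F_kl. The product of three Clifford
      generators is its totally antisymmetric part, which sees the cyclic sum
      of D_i F_kl, plus contractions, which see the divergence; both are zero
      ([clifford_cubic]).

    The Bianchi identity and the transformation of F need the symmetry of
    second derivatives, which is established first. *)

(* Unification would otherwise unfold derivatives into limits whenever it
   compares two different ones. *)
#[local] Opaque derive.

(** * Symmetry of second derivatives *)

Section Schwarz.
Variables (R : realType) (V : normedModType R).
Implicit Types (f g : V -> R) (x u v : V).

Lemma differentiable_ball f x (eps : R) : differentiable f x -> 0 < eps ->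
  exists2 d : R, 0 < d & forall w, `|w| < d ->
    `|f (x + w) - f x - 'd f x w| <= eps * `|w|.
Proof.
move=> /diff_locally fx e0.
have /eqaddoP/(_ _ e0)/nbhs_ballP[d d0 H] := fx.
exists d => // w wd; have := H w.
rewrite -ball_normE /= sub0r normrN => /(_ wd).
rewrite -[X in X <= _ -> _]/(`|f (w + x) - (f x + 'd f x w)|).
by rewrite [w + x]addrC opprD addrA.
Qed.

Definition second_diff f x u v (h : R) : R :=
  f (x + h *: u + h *: v) - f (x + h *: u) - f (x + h *: v) + f x.

(** The mean value theorem in the direction u turns the second difference into
    h times a first difference of the derivative along u, which is then
    linearized at x. *)
Lemma second_diff_approx f x u v (eps : R) : 0 < eps ->
  (\forall y \near x, differentiable f y) -> differentiable ('D_u f) x ->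
  \forall h \near 0^'+, `|second_diff f x u v h - h ^+ 2 * 'D_v ('D_u f) x| <= eps * h ^+ 2.
Proof.
move=> e0 /nbhs_ballP[d1 /= d10 fd] gd.
(* The linearization errors at two points of norm at most h (|u| + |v|) add up,
   hence the factor 2; the summand 1 only makes K nonzero. *)
pose K : R := 2 * (`|u| + `|v|) + 1.
have K0 : 0 < K by rewrite /K; have := normr_ge0 u; have := normr_ge0 v; lra.
have [d2 d20 gE] := differentiable_ball gd (divr_gt0 e0 K0).
pose d := Num.min d1 d2 / K.
have d0 : 0 < d by rewrite /d divr_gt0 // lt_min d10 d20.
near=> h.
have h0 : 0 < h by [].
have hd : h < d by near: h; apply: nbhs_right_lt.
pose w (a b : R) : V := a *: u + b *: v.
have wsmall a b : 0 <= a <= h -> 0 <= b <= h -> `|w a b| <= h * (`|u| + `|v|).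
  move=> /andP[a0 ah] /andP[b0 bh]; rewrite (le_trans (ler_normD _ _))//.
  by rewrite !normrZ !ger0_norm// mulrDr lerD// ler_wpM2r.
have hK : h * (`|u| + `|v|) < Num.min d1 d2.
  rewrite /d ltr_pdivlMr// in hd; apply: le_lt_trans hd.
  rewrite ler_pM2l// /K; have := normr_ge0 u; have := normr_ge0 v; lra.
have wd a b : 0 <= a <= h -> 0 <= b <= h -> `|w a b| < Num.min d1 d2.
  by move=> ah bh; apply: le_lt_trans hK; exact: wsmall.
have fdw a b : 0 <= a <= h -> 0 <= b <= h -> differentiable f (x + w a b).
  move=> ah bh; apply: fd; rewrite -ball_normE /= opprD addNKr normrN.
  by have := wd _ _ ah bh; rewrite lt_min => /andP[].
(* The second difference is the increment of p h - p 0 over [0, h]. *)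
pose p (b s : R) : R := f (x + w s b).
have pD b s : 0 <= b <= h -> 0 <= s <= h -> is_derive s 1 (p b) ('D_u f (x + w s b)).
  move=> bh sh.
  have E : p b = f \o (fun t : R => t *: u + (x + b *: v)).
    by apply/funext => t; rewrite /p /w /= addrCA.
  have D : is_diff s (fun t : R => t *: u + (x + b *: v)) ( *:%R^~ u).
    rewrite [X in is_diff _ _ X](_ : _ = ( *:%R^~ u : R -> V) + (fun=> 0)); last first.
      by apply/funext => t /=; rewrite /GRing.add/= addr0.
    exact: is_diffD.
  have F := fdw _ _ sh bh.
  have pE : s *: u + (x + b *: v) = x + w s b by rewrite /w addrCA.
  have F' : differentiable f (s *: u + (x + b *: v)) by rewrite pE.
  have D' : differentiable (fun t : R => t *: u + (x + b *: v)) s by exact: ex_diff.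
  split; first by apply: diff_derivable; rewrite E; exact: differentiable_comp.
  rewrite E deriveE; last exact: differentiable_comp.
  rewrite diff_comp// pE /= diff_val scale1r deriveE//.
have Hh : 0 <= h <= h by rewrite lexx ltW.
have H0 : 0 <= (0 : R) <= h by rewrite lexx ltW.
have qD s : 0 <= s <= h -> is_derive s 1 (p h - p 0)
    ('D_u f (x + w s h) - 'D_u f (x + w s 0)).
  by move=> sh; apply: is_deriveB; apply: pD.
have [||c] := @MVT R (p h - p 0)
    (fun s => 'D_u f (x + w s h) - 'D_u f (x + w s 0)) 0 h h0 _.
- move=> s; rewrite in_itv /= => /andP[s0 sh]; apply: qD.
  by rewrite !ltW.
- apply: derivable_within_continuous => s; rewrite in_itv /= => sh.
  exact: (@ex_derive _ _ _ _ _ _ _ (qD _ sh)).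
rewrite in_itv /= => /andP[c0 ch].
have Hc : 0 <= c <= h by rewrite !ltW.
rewrite subr0 => ME.
have -> : second_diff f x u v h = (p h h - p 0 h) - (p h 0 - p 0 0).
  by rewrite /second_diff /p /w !(scale0r, addr0, add0r) addrA; ring.
rewrite -[p h h - p 0 h]/((p h - p 0) h) -[p h 0 - p 0 0]/((p h - p 0) 0) ME (deriveE v gd).
have wd2 b : 0 <= b <= h -> `|w c b| < d2.
  by move=> bh; have := wd _ _ Hc bh; rewrite lt_min => /andP[].
have {wd2}G b : 0 <= b <= h -> `|'D_u f (x + w c b) - 'D_u f x - 'd ('D_u f) x (w c b)|
     <= eps * h / 2.
  move=> bh; apply: le_trans (gE _ (wd2 _ bh)) _.
  apply: le_trans (ler_wpM2l _ (wsmall _ _ Hc bh)) _; first by rewrite ltW// divr_gt0.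
  rewrite [leLHS](_ : _ = eps * h / 2 * (2 * (`|u| + `|v|) / K)); last by field; rewrite gt_eqF.
  rewrite ler_piMr//; first by rewrite divr_ge0// ltW// mulr_gt0.
  by rewrite ler_pdivrMr// mul1r /K; lra.
have lin : 'd ('D_u f) x (w c h) - 'd ('D_u f) x (w c 0) = h * 'd ('D_u f) x v.
  by rewrite /w -linearB /= opprD addrACA subrr add0r scale0r subr0 linearZ.
have {G} := (G _ Hh, G _ H0).
set a := 'D_u f (x + _); set b := 'D_u f (x + _); move: lin.
set la := 'd _ _ _; set lb := 'd _ _ _; set lv := 'd _ _ _ => lin [Ga Gb].
rewrite [X in `|X|](_ : _ = ((a - 'D_u f x - la) - (b - 'D_u f x - lb)) * h); last first.
  by rewrite expr2 -mulrA -lin; ring.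
rewrite normrM (gtr0_norm h0) expr2 mulrA (ler_wpM2r (ltW h0))//.
apply: le_trans (ler_normB _ _) _; apply: le_trans (lerD Ga Gb) _.
by rewrite -splitr.
Unshelve. all: by end_near. Qed.

(** Both mixed derivatives are the limit of the same second difference
    quotient. *)
Lemma derive_comm f x u v : (\forall y \near x, differentiable f y) ->
  differentiable ('D_u f) x -> differentiable ('D_v f) x ->
  'D_v ('D_u f) x = 'D_u ('D_v f) x.
Proof.
move=> fd du dv.
(* Abstracting the two derivatives keeps them from being compared. *)
suff H a b : (forall e : R, 0 < e -> \forall h \near 0^'+,
      `|second_diff f x u v h - h ^+ 2 * a| <= e * h ^+ 2) ->
    (forall e : R, 0 < e -> \forall h \near 0^'+,
      `|second_diff f x v u h - h ^+ 2 * b| <= e * h ^+ 2) -> a = b.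
  apply: H => e e0; [exact: (second_diff_approx v e0 fd du)|].
  exact: (second_diff_approx u e0 fd dv).
move=> Ha Hb; apply/eqP; rewrite -subr_eq0 -normr_le0; apply/ler_addgt0Pr => e e0.
have e20 : 0 < e / 2 by rewrite divr_gt0.
have [h [h0 A B]] : exists h : R, [/\ 0 < h,
    `|second_diff f x u v h - h ^+ 2 * a| <= e / 2 * h ^+ 2 &
    `|second_diff f x v u h - h ^+ 2 * b| <= e / 2 * h ^+ 2].
  apply: (@filter_ex _ (0 : R)^'+).
  by apply: filterS3 (nbhs_right_gt 0) (Ha _ e20) (Hb _ e20) => h; split.
have S : second_diff f x u v h = second_diff f x v u h.
  by rewrite /second_diff -!addrA [h *: u + h *: v]addrC; congr (_ + _); exact: addrCA.
rewrite add0r -(@ler_pM2l _ (h ^+ 2)) ?exprn_gt0//.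
rewrite -[X in X * `|_|](@ger0_norm _ (h ^+ 2)) ?exprn_ge0 ?(ltW h0)// -normrM.
rewrite [X in `|X|](_ : _ = (second_diff f x v u h - h ^+ 2 * b)
   - (second_diff f x u v h - h ^+ 2 * a)); last by rewrite S; ring.
apply: le_trans (ler_normB _ _) _; apply: le_trans (lerD B A) _.
by rewrite -mulrDl -splitr mulrC.
Qed.

End Schwarz.

(** * Smooth functions of four real variables *)

Lemma near_eq_differentiable (K : numFieldType) (V W : normedModType K) (f g : V -> W) x :
  (\near x, f x = g x) -> differentiable f x -> differentiable g x.
Proof.
move=> fg df.
have E : g \o shift x = cst (g x) + 'd f x +o_ 0 id.
  apply/eqaddoP => e e0.
  have /eqaddoP/(_ _ e0) := diff_locally df.
  have fg0 : \forall w \near (0 : V), f (w + x) = g (w + x).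
    by move: fg; rewrite (near_shift 0); apply: filterS => w; rewrite /= subr0.
  apply: filterS2 fg0 => w fgw.
  rewrite -[X in X <= _ -> _]/(`|f (w + x) - (f x + 'd f x w)|).
  rewrite -[X in _ -> X <= _]/(`|g (w + x) - (g x + 'd f x w)|).
  by rewrite fgw (nbhs_singleton fg).
apply/diff_locallyP; rewrite (diff_unique (diff_continuous df) E).
by split => //; exact: diff_continuous.
Qed.


Section RealSmooth.
Variable R : realType.
Local Notation V := 'rV[R]_4.
Implicit Types (f g : V -> R) (x u v : V) (U : set V).

(** The product rule describes derivatives only on U, so the induction on the
    order of differentiability has to pass between functions that agree on U. *)
Lemma Ck_eq n U f g : open U -> (forall x, U x -> f x = g x) ->
  Ck n U f -> Ck n U g.
Proof.
move=> oU; elim: n f g => [|n IH] f g fg.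
  move=> fc x Ux; have nfg : \near x, f x = g x.
    by apply: filterS (open_nbhs_nbhs (conj oU Ux)).
  rewrite /prop_for /continuous_at -(nbhs_singleton nfg).
  apply: cvg_trans (fc x Ux); apply: (@near_eq_cvg _ _ (nbhs x)).
  by move: nfg; apply: filterS => z ->.
move=> [fd fD]; split=> [x Ux|k].
  apply: near_eq_differentiable (fd x Ux).
  by apply: filterS (open_nbhs_nbhs (conj oU Ux)).
apply: IH (fD k) => x Ux; apply: near_eq_derive.
by apply: filterS (open_nbhs_nbhs (conj oU Ux)).
Qed.

Lemma CkS n U f : Ck n.+1 U f -> Ck n U f.
Proof.
elim: n f => [|n IH] f /= [fd fD].
  by move=> x Ux; apply: differentiable_continuous; exact: fd.
by split=> // k; apply: IH; exact: fD.
Qed.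

Lemma Ck_subset n (U W : set V) f : W `<=` U -> Ck n U f -> Ck n W f.
Proof.
move=> WU; elim: n f => [|n IH] f /=.
  by move=> fc x Wx; apply: fc; exact: WU.
by move=> [fd fD]; split=> [x /WU/fd//|k]; apply: IH.
Qed.

Lemma Ck_cst n U (a : R) : Ck n U (fun=> a).
Proof.
elim: n a => [|n IH] a /=; first by move=> x _; exact: cst_continuous.
split=> [x _|k]; first exact: differentiable_cst.
rewrite [X in Ck _ _ X](_ : _ = fun=> 0)//.
by apply/funext => x; rewrite derive_cst.
Qed.

Lemma CkD n U f g : open U -> Ck n U f -> Ck n U g -> Ck n U (fun x => f x + g x).
Proof.
move=> oU; elim: n f g => [|n IH] f g /=.
  by move=> fc gc x Ux; apply: continuousD; [exact: fc|exact: gc].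
move=> [fd fD] [gd gD]; split=> [x Ux|k].
  by apply: differentiableD; [exact: fd|exact: gd].
apply: Ck_eq (IH _ _ (fD k) (gD k)) => // x Ux.
by rewrite [RHS]deriveD//; apply: diff_derivable; [exact: fd|exact: gd].
Qed.

Lemma CkM n U f g : open U -> Ck n U f -> Ck n U g -> Ck n U (fun x => f x * g x).
Proof.
move=> oU; elim: n f g => [|n IH] f g.
  by move=> fc gc x Ux; apply: continuousM; [exact: fc|exact: gc].
move=> fS gS; have [f0 g0] := (CkS fS, CkS gS).
move: fS gS => [fd fD] [gd gD]; split=> [x Ux|k].
  by apply: differentiableM; [exact: fd|exact: gd].
apply: Ck_eq (CkD oU (IH _ _ f0 (gD k)) (IH _ _ (fD k) g0)) => // x Ux.
rewrite [RHS]deriveM//; try by apply: diff_derivable; [exact: fd|exact: gd].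
  by rewrite /GRing.scale /= [g x * _]mulrC.
all: by apply: diff_derivable; (exact: fd || exact: gd).
Qed.

Lemma differentiable_row (k : 'I_4) x : differentiable (fun z : V => z 0 k) x.
Proof. exact: differentiable_coord. Qed.

Lemma smooth_coord U (k : 'I_4) : smooth U (fun z => z 0 k).
Proof.
case=> [|n]; first by move=> x _; exact/differentiable_continuous/differentiable_row.
split=> [x _|l]; first exact: differentiable_row.
rewrite [X in Ck _ _ X](_ : _ = fun=> ebase R l 0 k); first exact: Ck_cst.
by apply/funext => x; have := is_derive_coord x (ebase R l) k => ?; rewrite derive_val.
Qed.

Lemma smooth_eq U f g : open U -> (forall x, U x -> f x = g x) ->
  smooth U f -> smooth U g.
Proof. by move=> oU fg fs n; exact: Ck_eq (fs n). Qed.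

Lemma smooth_cst U (a : R) : smooth U (fun=> a).
Proof. by move=> n; exact: Ck_cst. Qed.

Lemma smoothD U f g : open U -> smooth U f -> smooth U g -> smooth U (fun x => f x + g x).
Proof. by move=> oU fs gs n; exact: CkD. Qed.

Lemma smoothM U f g : open U -> smooth U f -> smooth U g -> smooth U (fun x => f x * g x).
Proof. by move=> oU fs gs n; exact: CkM. Qed.

Lemma smooth_derive U f k : smooth U f -> smooth U ('D_(ebase R k) f).
Proof. by move=> fs n; have [_] := fs n.+1; exact. Qed.

Lemma smooth_differentiable U f x : smooth U f -> U x -> differentiable f x.
Proof. by move=> fs Ux; have [+ _] := fs 1; exact. Qed.

Lemma smooth_derive_comm U f x k l : open U -> smooth U f -> U x ->
  'D_(ebase R k) ('D_(ebase R l) f) x = 'D_(ebase R l) ('D_(ebase R k) f) x.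
Proof.
move=> oU fs Ux; apply: derive_comm.
- apply: filterS (open_nbhs_nbhs (conj oU Ux)) => y Uy.
  exact: smooth_differentiable fs Uy.
- exact: smooth_differentiable (smooth_derive l fs) Ux.
- exact: smooth_differentiable (smooth_derive k fs) Ux.
Qed.

End RealSmooth.

(** * Complex-valued functions *)

Section ComplexCalculus.
Variable R : realType.
Local Notation V := 'rV[R]_4.
Local Notation C := R[i].
Local Notation Re := complex.Re.
Local Notation Im := complex.Im.
Implicit Types (f g : V -> C) (x u v : V) (U : set V).

Lemma ReD (z w : C) : Re (z + w) = Re z + Re w. Proof. by case: z w => [a b] []. Qed.
Lemma ImD (z w : C) : Im (z + w) = Im z + Im w. Proof. by case: z w => [a b] []. Qed.
Lemma ReM (z w : C) : Re (z * w) = Re z * Re w + - 1 * (Im z * Im w).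
Proof. by case: z w => [a b] [a' b'] /=; rewrite mulN1r. Qed.
Lemma ImM (z w : C) : Im (z * w) = Re z * Im w + Im z * Re w.
Proof. by case: z w => [a b] [a' b'] /=. Qed.

Lemma complex_ext (z w : C) : Re z = Re w -> Im z = Im w -> z = w.
Proof. by case: z w => [a b] [a' b'] /= -> ->. Qed.

Definition csmooth U f : Prop :=
  smooth U (fun x => Re (f x)) /\ smooth U (fun x => Im (f x)).

Definition cdiff f x : Prop :=
  differentiable (fun z => Re (f z)) x /\ differentiable (fun z => Im (f z)) x.

Lemma csmooth_cdiff U f x : csmooth U f -> U x -> cdiff f x.
Proof.
by move=> [fr fi] Ux; split; [exact: smooth_differentiable fr Ux|exact: smooth_differentiable fi Ux].
Qed.

Lemma csmooth_cst U (a : C) : csmooth U (fun=> a).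
Proof. by split; exact: smooth_cst. Qed.

Lemma csmooth_real U (f : V -> R) : smooth U f -> csmooth U (fun x => (f x)%:C).
Proof. by move=> fs; split => //=; exact: smooth_cst. Qed.

Lemma csmooth_eq U f g : open U -> (forall x, U x -> f x = g x) ->
  csmooth U f -> csmooth U g.
Proof.
move=> oU fg [fr fi]; split.
  by apply: (smooth_eq oU _ fr) => x /fg ->.
by apply: (smooth_eq oU _ fi) => x /fg ->.
Qed.

Lemma csmoothD U f g : open U -> csmooth U f -> csmooth U g ->
  csmooth U (fun x => f x + g x).
Proof.
move=> oU [fr fi] [gr gi]; split.
  by under eq_fun do rewrite ReD; exact: smoothD.
by under eq_fun do rewrite ImD; exact: smoothD.
Qed.

Lemma csmoothM U f g : open U -> csmooth U f -> csmooth U g ->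
  csmooth U (fun x => f x * g x).
Proof.
move=> oU [fr fi] [gr gi]; split.
  under eq_fun do rewrite ReM.
  by apply: smoothD => //; [|apply: smoothM => //; [exact: smooth_cst|]]; exact: smoothM.
by under eq_fun do rewrite ImM; apply: smoothD => //; exact: smoothM.
Qed.

Lemma csmooth_sum U (I : Type) (s : seq I) (P : pred I) (f : I -> V -> C) : open U ->
  (forall i, csmooth U (f i)) -> csmooth U (fun x => \sum_(i <- s | P i) f i x).
Proof.
move=> oU fs; elim: s => [|i s IH].
  by under eq_fun do rewrite big_nil; exact: csmooth_cst.
under eq_fun do rewrite big_cons.
by case: (P i) => //; exact: csmoothD.
Qed.

Lemma csmooth_dir U f k : csmooth U f -> csmooth U (dirC (ebase R k) f).
Proof. by move=> [fr fi]; split; exact: smooth_derive. Qed.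

Lemma cdiff_cst (a : C) x : cdiff (fun=> a) x.
Proof. by split; exact: differentiable_cst. Qed.

Lemma cdiff_real (f : V -> R) x : differentiable f x -> cdiff (fun z => (f z)%:C) x.
Proof. by move=> fd; split => //=; exact: differentiable_cst. Qed.

Lemma cdiffD f g x : cdiff f x -> cdiff g x -> cdiff (fun z => f z + g z) x.
Proof.
move=> [fr fi] [gr gi]; split.
  by under eq_fun do rewrite ReD; exact: differentiableD.
by under eq_fun do rewrite ImD; exact: differentiableD.
Qed.

Lemma cdiffM f g x : cdiff f x -> cdiff g x -> cdiff (fun z => f z * g z) x.
Proof.
move=> [fr fi] [gr gi]; split.
  under eq_fun do rewrite ReM.
  by apply: differentiableD; [|apply: differentiableM => //]; exact: differentiableM.
by under eq_fun do rewrite ImM; apply: differentiableD => //; exact: differentiableM.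
Qed.

Lemma cdiff_sum (I : Type) (s : seq I) (P : pred I) (f : I -> V -> C) x :
  (forall i, cdiff (f i) x) -> cdiff (fun z => \sum_(i <- s | P i) f i z) x.
Proof.
move=> fs; elim: s => [|i s IH].
  by under eq_fun do rewrite big_nil; exact: cdiff_cst.
under eq_fun do rewrite big_cons.
by case: (P i) => //; exact: cdiffD.
Qed.

Lemma eq_dirC v f g x : (\near x, f x = g x) -> dirC v f x = dirC v g x.
Proof.
move=> fg; rewrite /dirC; congr (_ +i* _); apply: near_eq_derive.
  by apply: filterS fg => z ->.
by apply: filterS fg => z ->.
Qed.

Lemma dirC_ext v f g x : f =1 g -> dirC v f x = dirC v g x.
Proof. by move=> /funext ->. Qed.

Lemma dirC_cst v (a : C) x : dirC v (fun=> a) x = 0.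
Proof. by rewrite /dirC !derive_cst. Qed.

Lemma dirC_real v (f : V -> R) x : dirC v (fun z => (f z)%:C) x = ('D_v f x)%:C.
Proof. by rewrite /dirC /= derive_cst. Qed.

Lemma dirCD v f g x : cdiff f x -> cdiff g x ->
  dirC v (fun z => f z + g z) x = dirC v f x + dirC v g x.
Proof.
move=> [fr fi] [gr gi].
pose fR z := Re (f z); pose fI z := Im (f z); pose gR z := Re (g z); pose gI z := Im (g z).
have dr : 'D_v (fun z => Re (f z + g z)) x = 'D_v fR x + 'D_v gR x.
  rewrite (_ : (fun z => _) = fR + gR); last by apply/funext => z; rewrite ReD.
  by rewrite deriveD//; exact: diff_derivable.
have di : 'D_v (fun z => Im (f z + g z)) x = 'D_v fI x + 'D_v gI x.
  rewrite (_ : (fun z => _) = fI + gI); last by apply/funext => z; rewrite ImD.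
  by rewrite deriveD//; exact: diff_derivable.
by rewrite /dirC dr di.
Qed.

Lemma dirCM v f g x : cdiff f x -> cdiff g x ->
  dirC v (fun z => f z * g z) x = dirC v f x * g x + f x * dirC v g x.
Proof.
move=> [fr fi] [gr gi].
pose fR z := Re (f z); pose fI z := Im (f z); pose gR z := Re (g z); pose gI z := Im (g z).
have dr : 'D_v (fun z => Re (f z * g z)) x =
    fR x * 'D_v gR x + gR x * 'D_v fR x - (fI x * 'D_v gI x + gI x * 'D_v fI x).
  rewrite (_ : (fun z => _) = fR * gR - fI * gI); last first.
    by apply/funext => z; rewrite ReM mulN1r.
  rewrite deriveB; try by apply: derivableM; exact: diff_derivable.
  by rewrite !deriveM//; exact: diff_derivable.
have di : 'D_v (fun z => Im (f z * g z)) x =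
    fR x * 'D_v gI x + gI x * 'D_v fR x + (fI x * 'D_v gR x + gR x * 'D_v fI x).
  rewrite (_ : (fun z => _) = fR * gI + fI * gR); last first.
    by apply/funext => z; rewrite ImM.
  rewrite deriveD; try by apply: derivableM; exact: diff_derivable.
  by rewrite !deriveM//; exact: diff_derivable.
rewrite /dirC dr di -/fR -/fI -/gR -/gI.
rewrite [f x](_ : _ = fR x +i* fI x); last by rewrite /fR /fI; case: (f x).
rewrite [g x](_ : _ = gR x +i* gI x); last by rewrite /gR /gI; case: (g x).
by apply: complex_ext; rewrite ?ReD ?ImD ?ReM ?ImM /=; ring.
Qed.

Lemma dirC_sum v (I : Type) (s : seq I) (P : pred I) (f : I -> V -> C) x :
  (forall i, cdiff (f i) x) ->
  dirC v (fun z => \sum_(i <- s | P i) f i z) x = \sum_(i <- s | P i) dirC v (f i) x.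
Proof.
move=> fs; elim: s => [|i s IH].
  by under eq_fun do rewrite big_nil; rewrite dirC_cst big_nil.
under eq_fun do rewrite big_cons; rewrite big_cons.
by case: (P i) => //; rewrite dirCD// ?IH//; exact: cdiff_sum.
Qed.

Lemma dirC_scale (a : R) v f x : cdiff f x -> dirC (a *: v) f x = a%:C * dirC v f x.
Proof.
have D (h : V -> R) : differentiable h x -> 'D_(a *: v) h x = a * 'D_v h x.
  by move=> hd; rewrite !(deriveE _ hd) linearZ.
move=> [fr fi]; apply: complex_ext; rewrite ?ReM ?ImM /=.
  by rewrite [LHS](D _ fr) mul0r mulr0 addr0.
by rewrite [LHS](D _ fi) mul0r addr0.
Qed.

Lemma dirC_comm U f x k l : open U -> csmooth U f -> U x ->
  dirC (ebase R k) (dirC (ebase R l) f) x = dirC (ebase R l) (dirC (ebase R k) f) x.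
Proof.
move=> oU [fr fi] Ux.
exact: (f_equal2 (@Complex R) (smooth_derive_comm k l oU fr Ux) (smooth_derive_comm k l oU fi Ux)).
Qed.

Lemma derive_comp (f : V -> R) (h : V -> V) v x :
  (forall l, differentiable (fun z => h z 0 l) x) -> differentiable f (h x) ->
  'D_v (fun z => f (h z)) x =
  \sum_l 'D_v (fun z => h z 0 l) x * 'D_(ebase R l) f (h x).
Proof.
move=> hd fd.
have hE : h = \sum_l (fun z => h z 0 l *: ebase R l).
  by apply/funext => z; rewrite fct_sumE [LHS]row_sum_delta.
have hdx : differentiable h x.
  by rewrite hE; apply: differentiable_sum => l; exact: differentiableZl.
rewrite -[fun z => f (h z)]/(f \o h) deriveE; last exact: differentiable_comp.
rewrite diff_comp//= [X in 'd f _ X](_ : _ = \sum_l 'D_v (fun z => h z 0 l) x *: ebase R l).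
  by rewrite linear_sum; apply: eq_bigr => l _; rewrite linearZ /= -deriveE.
rewrite -deriveE// [in LHS]hE derive_sum => [|l]; last first.
  by apply: diff_derivable; exact: differentiableZl.
apply: eq_bigr => l _; rewrite deriveE; last exact: differentiableZl.
by rewrite diffZl//= deriveE.
Qed.

Lemma dirC_comp f (h : V -> V) v x :
  (forall l, differentiable (fun z => h z 0 l) x) -> cdiff f (h x) ->
  dirC v (fun z => f (h z)) x =
  \sum_l ('D_v (fun z => h z 0 l) x)%:C * dirC (ebase R l) f (h x).
Proof.
move=> hd [fr fi].
have E (z : C) (a : R) : Re (a%:C * z) = a * Re z /\ Im (a%:C * z) = a * Im z.
  by rewrite ReM ImM /= !mul0r mulr0 !addr0.
have RS (F : 'I_4 -> C) : Re (\sum_l F l) = \sum_l Re (F l).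
  by elim/big_rec2: _ => // l a b _ <-; rewrite ReD.
have IS (F : 'I_4 -> C) : Im (\sum_l F l) = \sum_l Im (F l).
  by elim/big_rec2: _ => // l a b _ <-; rewrite ImD.
apply: complex_ext; [rewrite RS|rewrite IS].
  rewrite [LHS](derive_comp (f := fun z => Re (f z)) _ hd fr).
  by apply: eq_bigr => l _; rewrite (E _ _).1.
rewrite [LHS](derive_comp (f := fun z => Im (f z)) _ hd fi).
by apply: eq_bigr => l _; rewrite (E _ _).2.
Qed.

End ComplexCalculus.

(** * Matrix-valued functions *)

Section MatrixCalculus.
Variable R : realType.
Local Notation V := 'rV[R]_4.
Local Notation C := R[i].
Implicit Types (x u v : V) (U : set V).

Definition mdiff m n (f : V -> 'M[C]_(m, n)) x : Prop :=
  forall a b, cdiff (fun z => f z a b) x.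

Section Smooth.
Variable U : set V.
Hypothesis oU : open U.

Lemma smooth_mx_mdiff m n (f : V -> 'M[C]_(m, n)) x :
  smooth_mx U f -> U x -> mdiff f x.
Proof. by move=> fs Ux a b; exact: csmooth_cdiff (fs a b) Ux. Qed.

Lemma smooth_mx_eq m n (f g : V -> 'M[C]_(m, n)) : (forall x, U x -> f x = g x) ->
  smooth_mx U f -> smooth_mx U g.
Proof. by move=> fg fs a b; apply: (csmooth_eq oU _ (fs a b)) => x /fg ->. Qed.

Lemma smooth_mx_cst m n (M : 'M[C]_(m, n)) : smooth_mx U (fun=> M).
Proof. by move=> a b; exact: csmooth_cst. Qed.

Lemma smooth_mxD m n (f g : V -> 'M[C]_(m, n)) : smooth_mx U f -> smooth_mx U g ->
  smooth_mx U (fun x => f x + g x).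
Proof.
move=> fs gs a b; apply: (@csmooth_eq _ _ (fun x => f x a b + g x a b)) => //.
  by move=> x _; rewrite mxE.
by apply: csmoothD.
Qed.

Lemma smooth_mxZ m n (h : V -> C) (f : V -> 'M[C]_(m, n)) : csmooth U h -> smooth_mx U f ->
  smooth_mx U (fun x => h x *: f x).
Proof.
move=> hs fs a b; apply: (@csmooth_eq _ _ (fun x => h x * f x a b)) => //.
  by move=> x _; rewrite mxE.
by apply: csmoothM.
Qed.

Lemma smooth_mxN m n (f : V -> 'M[C]_(m, n)) : smooth_mx U f ->
  smooth_mx U (fun x => - f x).
Proof.
move=> fs; apply: smooth_mx_eq (smooth_mxZ (csmooth_cst _ (-1)) fs).
by move=> x _; rewrite scaleN1r.
Qed.

Lemma smooth_mxM m n p (f : V -> 'M[C]_(m, n)) (g : V -> 'M[C]_(n, p)) :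
  smooth_mx U f -> smooth_mx U g -> smooth_mx U (fun x => f x *m g x).
Proof.
move=> fs gs a b; apply: (@csmooth_eq _ _ (fun x => \sum_j f x a j * g x j b)) => //.
  by move=> x _; rewrite mxE.
by apply: csmooth_sum => // j; exact: csmoothM.
Qed.

Lemma smooth_mx_sum m n (I : Type) (s : seq I) (P : pred I) (f : I -> V -> 'M[C]_(m, n)) :
  (forall i, smooth_mx U (f i)) -> smooth_mx U (fun x => \sum_(i <- s | P i) f i x).
Proof.
move=> fs; elim: s => [|i s IH].
  by under eq_fun do rewrite big_nil; exact: smooth_mx_cst.
under eq_fun do rewrite big_cons.
by case: (P i) => //; exact: smooth_mxD.
Qed.

Lemma smooth_mx_partial m n (f : V -> 'M[C]_(m, n)) k : smooth_mx U f ->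
  smooth_mx U (partial k f).
Proof.
move=> fs a b; apply: csmooth_eq (csmooth_dir k (fs a b)) => // x _.
by rewrite mxE.
Qed.

Lemma smooth_mx_subset m n (W : set V) (f : V -> 'M[C]_(m, n)) : U `<=` W ->
  smooth_mx W f -> smooth_mx U f.
Proof.
move=> UW fs a b; have [fr fi] := fs a b.
by split=> k; [apply: Ck_subset UW (fr k)|apply: Ck_subset UW (fi k)].
Qed.

Lemma partial_comm m n (f : V -> 'M[C]_(m, n)) x k l : smooth_mx U f -> U x ->
  partial k (partial l f) x = partial l (partial k f) x.
Proof.
have E (j i : 'I_4) a b : partial j (partial i f) x a b =
    dirC (ebase R j) (dirC (ebase R i) (fun z => f z a b)) x.
  by rewrite mxE; apply: dirC_ext => z; rewrite mxE.
move=> fs Ux; apply/matrixP => a b.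
exact: (etrans (E k l a b) (etrans (dirC_comm k l oU (fs a b) Ux) (esym (E l k a b)))).
Qed.

End Smooth.

Section Dir.
Variables (x v : V).

Lemma mdiff_cst m n (M : 'M[C]_(m, n)) : mdiff (fun=> M) x.
Proof. by move=> a b; exact: cdiff_cst. Qed.

Lemma mdiffD m n (f g : V -> 'M[C]_(m, n)) : mdiff f x -> mdiff g x ->
  mdiff (fun z => f z + g z) x.
Proof.
move=> fd gd a b; rewrite (_ : (fun z => _) = fun z => f z a b + g z a b).
  exact: cdiffD.
by apply/funext => z; rewrite mxE.
Qed.

Lemma mdiffZ m n (h : V -> C) (f : V -> 'M[C]_(m, n)) : cdiff h x -> mdiff f x ->
  mdiff (fun z => h z *: f z) x.
Proof.
move=> hd fd a b; rewrite (_ : (fun z => _) = fun z => h z * f z a b).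
  exact: cdiffM.
by apply/funext => z; rewrite mxE.
Qed.

Lemma mdiffM m n p (f : V -> 'M[C]_(m, n)) (g : V -> 'M[C]_(n, p)) :
  mdiff f x -> mdiff g x -> mdiff (fun z => f z *m g z) x.
Proof.
move=> fd gd a b; rewrite (_ : (fun z => _) = fun z => \sum_j f z a j * g z j b).
  by apply: cdiff_sum => j; exact: cdiffM.
by apply/funext => z; rewrite mxE.
Qed.

Lemma mdiff_sum m n (I : Type) (s : seq I) (P : pred I) (f : I -> V -> 'M[C]_(m, n)) :
  (forall i, mdiff (f i) x) -> mdiff (fun z => \sum_(i <- s | P i) f i z) x.
Proof.
move=> fs; elim: s => [|i s IH].
  by under eq_fun do rewrite big_nil; exact: mdiff_cst.
under eq_fun do rewrite big_cons.
by case: (P i) => //; exact: mdiffD.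
Qed.

Lemma eq_dir m n (f g : V -> 'M[C]_(m, n)) : (\near x, f x = g x) ->
  dir v f x = dir v g x.
Proof.
move=> fg; apply/matrixP => a b; rewrite !mxE; apply: eq_dirC.
by apply: filterS fg => z ->.
Qed.

Lemma dir_cst m n (M : 'M[C]_(m, n)) : dir v (fun=> M) x = 0.
Proof. by apply/matrixP => a b; rewrite !mxE dirC_cst. Qed.

Lemma dirD m n (f g : V -> 'M[C]_(m, n)) : mdiff f x -> mdiff g x ->
  dir v (fun z => f z + g z) x = dir v f x + dir v g x.
Proof.
move=> fd gd; apply/matrixP => a b; rewrite !mxE -dirCD//.
by apply: dirC_ext => z; rewrite mxE.
Qed.

Lemma dirZ m n (h : V -> C) (f : V -> 'M[C]_(m, n)) : cdiff h x -> mdiff f x ->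
  dir v (fun z => h z *: f z) x = dirC v h x *: f x + h x *: dir v f x.
Proof.
move=> hd fd; apply/matrixP => a b; rewrite !mxE -dirCM//.
by apply: dirC_ext => z; rewrite mxE.
Qed.

Lemma dirM m n p (f : V -> 'M[C]_(m, n)) (g : V -> 'M[C]_(n, p)) :
  mdiff f x -> mdiff g x ->
  dir v (fun z => f z *m g z) x = dir v f x *m g x + f x *m dir v g x.
Proof.
move=> fd gd; apply/matrixP => a b; rewrite !mxE.
rewrite (_ : (fun z => _) = fun z => \sum_j f z a j * g z j b); last first.
  by apply/funext => z; rewrite mxE.
rewrite dirC_sum => [|j]; last exact: cdiffM.
rewrite -big_split; apply: eq_bigr => j _.
by rewrite dirCM// !mxE.
Qed.

Lemma dir_sum m n (I : Type) (s : seq I) (P : pred I) (f : I -> V -> 'M[C]_(m, n)) :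
  (forall i, mdiff (f i) x) ->
  dir v (fun z => \sum_(i <- s | P i) f i z) x = \sum_(i <- s | P i) dir v (f i) x.
Proof.
move=> fs; elim: s => [|i s IH].
  by under eq_fun do rewrite big_nil; rewrite dir_cst big_nil.
under eq_fun do rewrite big_cons; rewrite big_cons.
by case: (P i) => //; rewrite dirD// ?IH//; exact: mdiff_sum.
Qed.

Lemma mdiffN m n (f : V -> 'M[C]_(m, n)) : mdiff f x -> mdiff (fun z => - f z) x.
Proof.
move=> fd; rewrite (_ : (fun z => _) = fun z => -1 *: f z).
  by apply: mdiffZ => //; exact: cdiff_cst.
by apply/funext => z; rewrite scaleN1r.
Qed.

Lemma dirN m n (f : V -> 'M[C]_(m, n)) : mdiff f x ->
  dir v (fun z => - f z) x = - dir v f x.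
Proof.
move=> fd; rewrite (_ : (fun z => _) = fun z => -1 *: f z).
  by rewrite dirZ ?dirC_cst ?scale0r ?add0r ?scaleN1r//; exact: cdiff_cst.
by apply/funext => z; rewrite scaleN1r.
Qed.

Lemma dir_scale m n (a : R) (f : V -> 'M[C]_(m, n)) : mdiff f x ->
  dir (a *: v) f x = a%:C *: dir v f x.
Proof. by move=> fd; apply/matrixP => i j; rewrite !mxE dirC_scale. Qed.

Lemma dir_comp m n (f : V -> 'M[C]_(m, n)) (h : V -> V) :
  (forall l, differentiable (fun z => h z 0 l) x) -> mdiff f (h x) ->
  dir v (fun z => f (h z)) x =
  \sum_l ('D_v (fun z => h z 0 l) x)%:C *: partial l f (h x).
Proof.
move=> hd fd; apply/matrixP => a b; rewrite mxE summxE.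
rewrite (dirC_comp v hd (fd a b)); apply: eq_bigr => l _.
by rewrite !mxE.
Qed.

Lemma mdiff_comp m n (f : V -> 'M[C]_(m, n)) (h : V -> V) :
  (forall l, differentiable (fun z => h z 0 l) x) -> mdiff f (h x) ->
  mdiff (fun z => f (h z)) x.
Proof.
move=> hd fd a b; have [fr fi] := fd a b.
have hE : h = \sum_l (fun z => h z 0 l *: ebase R l).
  by apply/funext => z; rewrite fct_sumE [LHS]row_sum_delta.
have hdx : differentiable h x.
  by rewrite hE; apply: differentiable_sum => l; exact: differentiableZl.
by split; [exact: (differentiable_comp hdx fr)|exact: (differentiable_comp hdx fi)].
Qed.

End Dir.
End MatrixCalculus.

(** * The stereographic charts *)

Section Stereographic.
Variable R : realType.
Local Notation V := 'rV[R]_4.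
Implicit Types (c : bool) (x u v : V).

(** The conformal factor: the frame e_k is rho times the coordinate field. *)
Definition rho x : R := (1 + sqnorm x) / 2.

Lemma sqnorm_ge0 x : 0 <= sqnorm x.
Proof. by apply: sumr_ge0 => k _; exact: sqr_ge0. Qed.

Lemma rho_gt0 x : 0 < rho x.
Proof. by rewrite divr_gt0// ltr_pwDl// sqnorm_ge0. Qed.

Lemma rho_neq0 x : rho x != 0. Proof. by rewrite gt_eqF// rho_gt0. Qed.

Lemma sqnorm1_neq0 x : 1 + sqnorm x != 0.
Proof. by rewrite gt_eqF// ltr_pwDl// sqnorm_ge0. Qed.

Lemma differentiable_sqnorm x : differentiable (@sqnorm R 4) x.
Proof.
have -> : @sqnorm R 4 = \sum_(k < 4) (fun z : V => z 0 k) ^+ 2.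
  by apply/funext => z; rewrite fct_sumE.
apply: differentiable_sum => k; apply: differentiableX.
exact: differentiable_row.
Qed.

Lemma derive_sqnorm x u : 'D_u (@sqnorm R 4) x = 2 * dot x u.
Proof. by have H := is_derive_sqnorm x u; rewrite derive_val. Qed.

Lemma derive_row x u k : 'D_u (fun z : V => z 0 k) x = u 0 k.
Proof. by have H := is_derive_coord x u k; rewrite derive_val. Qed.

Lemma dot_ebase x k : dot x (ebase R k) = x 0 k.
Proof.
rewrite /dot (bigD1 k)//= big1 ?addr0 ?mxE ?eqxx ?mulr1// => i /negPf ik.
by rewrite mxE ik mulr0.
Qed.

Lemma dotZ x (a : R) u : dot x (a *: u) = a * dot x u.
Proof. by rewrite /dot mulr_sumr; apply: eq_bigr => i _; rewrite mxE mulrCA. Qed.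

Lemma rhoE : rho = 2^-1 *: (cst 1 + @sqnorm R 4) :> (V -> R).
Proof. by apply/funext => z; rewrite /rho mulrC. Qed.

Lemma differentiable_rho x : differentiable rho x.
Proof.
rewrite rhoE; apply/differentiableZ/differentiableD => //.
exact: differentiable_sqnorm.
Qed.

Lemma derive_rho x u : 'D_u rho x = dot x u.
Proof.
have d := @diff_derivable _ _ _ _ _ u (differentiable_sqnorm x).
have d1 : derivable (cst 1 : V -> R) x u by exact: derivable_cst.
rewrite rhoE (deriveZ _ (derivableD d1 d)) (deriveD d1 d).
by rewrite derive_cst derive_sqnorm add0r /GRing.scale /= mulKf.
Qed.

Lemma smooth_sum (U : set V) n (f : 'I_n -> V -> R) : open U ->
  (forall i, smooth U (f i)) -> smooth U (fun z => \sum_i f i z).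
Proof.
move=> oU fs; elim: (index_enum _) => [|i s IH].
  by under eq_fun do rewrite big_nil; exact: smooth_cst.
by under eq_fun do rewrite big_cons; exact: smoothD.
Qed.

Lemma smooth_rho (U : set V) : open U -> smooth U rho.
Proof.
move=> oU; apply: smoothM => //; last exact: smooth_cst.
apply: smoothD => //; first exact: smooth_cst.
by apply: smooth_sum => // k; apply: smoothM => //; exact: smooth_coord.
Qed.

Lemma frameE k x : frame k x = rho x *: ebase R k. Proof. by []. Qed.

Lemma stereo_continuous c : continuous (@stereo R c).
Proof.
move=> x; apply: differentiable_continuous.
have -> : @stereo R c = \sum_(a < 5) (fun z => stereo c z 0 a *: delta_mx 0 a).
  by apply/funext => z; rewrite fct_sumE [LHS]row_sum_delta.
apply: differentiable_sum => a; apply: differentiableZl.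
have dV : differentiable (fun z : V => (1 + sqnorm z)^-1) x.
  apply: differentiableV; last exact: sqnorm1_neq0.
  by apply: differentiableD => //; exact: differentiable_sqnorm.
have dM (p : V -> R) : differentiable p x ->
    (forall z, stereo c z 0 a = (1 + sqnorm z)^-1 * p z) ->
    differentiable (fun z => stereo c z 0 a) x.
  move=> pd pE; have -> : (fun z => stereo c z 0 a) = (fun z => (1 + sqnorm z)^-1) * p.
    by apply/funext => z; rewrite pE.
  exact: differentiableM.
have [k aE|k aE] := split_ordP (a : 'I_(4 + 1)); rewrite {}aE in dM *.
  apply: (dM (fun z => (if c && (k == 0) then -2 else 2) * z 0 k)).
    by apply: differentiableM => //; exact: differentiable_row.
  by move=> z; rewrite /stereo mxE row_mxEl !mxE; case: ifP => _; ring.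
apply: (dM (fun z => (if c then 1 else -1) * (sqnorm z - 1))).
  apply: differentiableM => //; apply: differentiableB => //.
  exact: differentiable_sqnorm.
by move=> z; rewrite /stereo mxE row_mxEr !mxE ord1 eqxx mulr1n; case: ifP => _; ring.
Qed.

Lemma open_dom r (E : vector_bundle R r) (i : vb_idx E) c : open (dom i c).
Proof.
rewrite (_ : dom i c = @stereo R c @^-1` vb_dom i)//.
by apply: open_comp; [move=> z _; exact: stereo_continuous|exact: vb_open].
Qed.

Lemma lie_bracket_frame (i j : 'I_4) x m :
  lie_bracket (frame i) (frame j) x 0 m =
  rho x * (x 0 i * (m == j)%:R - x 0 j * (m == i)%:R).
Proof.
have D (k l : 'I_4) : 'D_(frame k x) (fun z => frame l z 0 m) x = rho x * x 0 k * (m == l)%:R.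
  have -> : (fun z => frame l z 0 m) = (m == l)%:R *: rho.
    by apply/funext => z; rewrite !mxE eqxx mulrC.
  rewrite deriveZ; last exact/diff_derivable/differentiable_rho.
  by rewrite derive_rho frameE dotZ dot_ebase /GRing.scale /= mulrC.
by rewrite !mxE !D; ring.
Qed.

Lemma round_metric_frame c x u k : round_metric c x u (frame k x) = u 0 k / rho x.
Proof.
rewrite round_metricE (bigD1 k)//= big1; last first.
  by move=> i /negPf ik; rewrite !mxE ik mulr0 mulr0.
rewrite !mxE !eqxx addr0 mulr1 /rho; have := sqnorm1_neq0 x => h.
by field; rewrite h.
Qed.

(** Since the derivative of rho along d/dx_i is x_i, the brackets are
    [e_i, e_j] = x_i e_j - x_j e_i. Of the six Koszul terms two cancel and the
    others add up in pairs. *)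
Lemma levi_civitaE c x (i j k : 'I_4) :
  levi_civita c x i j k = x 0 k * (i == j)%:R - x 0 j * (i == k)%:R.
Proof.
rewrite /levi_civita !round_metric_frame !lie_bracket_frame.
rewrite [k == j]eq_sym [k == i]eq_sym [j == i]eq_sym.
have := rho_neq0 x => h; field; exact: h.
Qed.

(** The sign of the coordinate l under the reflection in [trans]. *)
Definition sgn_flip (l : 'I_4) : R := if l == 0 then -1 else 1.

Lemma sgn_flip2 l : sgn_flip l * sgn_flip l = 1.
Proof. by rewrite /sgn_flip; case: ifP; rewrite ?mulrNN mulr1. Qed.

Lemma trans_coord x l : trans x 0 l = sgn_flip l * (x 0 l / sqnorm x).
Proof. by rewrite !mxE /sgn_flip /=; case: ifP => _; ring. Qed.

Lemma differentiable_trans x l : x != 0 -> differentiable (fun z : V => trans z 0 l) x.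
Proof.
rewrite -sqnorm_eq0 => x0.
have -> : (fun z : V => trans z 0 l) =
    sgn_flip l *: ((fun z : V => z 0 l) * (fun z => (sqnorm z)^-1)).
  by apply/funext => z; rewrite trans_coord.
apply: differentiableZ; apply: differentiableM; first exact: differentiable_row.
by apply: differentiableV => //; exact: differentiable_sqnorm.
Qed.

Lemma jacE x (l k : 'I_4) : x != 0 ->
  jac x l k = sgn_flip l *
    ((l == k)%:R / sqnorm x - 2 * x 0 l * x 0 k / (sqnorm x * sqnorm x)).
Proof.
rewrite -sqnorm_eq0 => x0.
have dq := @diff_derivable _ _ _ _ _ (ebase R k) (differentiable_sqnorm x).
have dr := @diff_derivable _ _ _ _ _ (ebase R k) (differentiable_row l x).
rewrite /jac; have -> : (fun z : V => trans z 0 l) =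
    sgn_flip l *: ((fun z : V => z 0 l) * (fun z => (sqnorm z)^-1)).
  by apply/funext => z; rewrite trans_coord.
have dV := derivableV x0 dq.
rewrite (deriveZ _ (derivableM dr dV)) (deriveM dr dV) (deriveV x0 dq).
rewrite derive_sqnorm derive_row dot_ebase mxE eqxx /GRing.scale /= -exprVn.
by field; exact: x0.
Qed.

Lemma open_neq0 : open [set x : V | x != 0].
Proof.
have -> : [set x : V | x != 0] = ~` [set 0].
  by apply/seteqP; split=> x /= /eqP.
exact/closed_openC/accessible_closed_set1/hausdorff_accessible/norm_hausdorff.
Qed.

Lemma differentiable_jac x (l k : 'I_4) : x != 0 -> differentiable (fun z => jac z l k) x.
Proof.
move=> x0; have q0 : sqnorm x != 0 by rewrite sqnorm_eq0.
apply: (@near_eq_differentiable _ _ _ (fun z : V => sgn_flip l *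
    ((l == k)%:R / sqnorm z - 2 * z 0 l * z 0 k / (sqnorm z * sqnorm z)))).
  apply: filterS (open_nbhs_nbhs (conj open_neq0 x0)) => z z0.
  by rewrite jacE.
have row (i : 'I_4) : differentiable (fun z : V => z 0 i) x by exact: differentiable_row.
have q := differentiable_sqnorm x.
have V1 : differentiable (fun z : V => (sqnorm z)^-1) x by exact: differentiableV.
have V2 : differentiable (fun z : V => (sqnorm z * sqnorm z)^-1) x.
  by apply: (differentiableV (differentiableM q q)); exact: mulf_neq0.
apply: differentiableM => //; apply: differentiableB; first exact: differentiableM.
by apply: differentiableM => //; apply: differentiableM => //; exact: differentiableM.
Qed.

Lemma jac_comm x (l k m : 'I_4) : x != 0 ->
  'D_(ebase R k) (fun z => jac z l m) x = 'D_(ebase R m) (fun z => jac z l k) x.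
Proof.
move=> x0; apply: (derive_comm _ (differentiable_jac l m x0) (differentiable_jac l k x0)).
apply: filterS (open_nbhs_nbhs (conj open_neq0 x0)) => z z0.
exact: differentiable_trans.
Qed.

Lemma rho_trans x : x != 0 -> rho (trans x) = rho x / sqnorm x.
Proof.
move=> x0; have q0 : sqnorm x != 0 by rewrite sqnorm_eq0.
by rewrite /rho sqnorm_trans//; field.
Qed.

Lemma frame_transE x (l k : 'I_4) : x != 0 ->
  frame_trans x l k = sqnorm x * jac x l k.
Proof.
move=> x0; have q0 : sqnorm x != 0 by rewrite sqnorm_eq0.
rewrite /frame_trans /coframe round_metric_frame mxE (bigD1 k)//= big1; last first.
  by move=> i /negPf ik; rewrite !mxE ik !mulr0.
rewrite !mxE !eqxx addr0 mulr1 rho_trans// -/(rho x).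
by have h := rho_neq0 x; field; rewrite q0.
Qed.

(** The differential of an inversion is a multiple of a reflection. *)
Lemma frame_trans_orthogonal x (m p : 'I_4) : x != 0 ->
  \sum_k frame_trans x m k * frame_trans x p k = (m == p)%:R.
Proof.
move=> x0; have q0 : sqnorm x != 0 by rewrite sqnorm_eq0.
pose s := sgn_flip; pose q := sqnorm x.
have E k : frame_trans x m k * frame_trans x p k = s m * s p *
    ((m == k)%:R * (p == k)%:R - 2 / q * x 0 p * ((m == k)%:R * x 0 k)
     - 2 / q * x 0 m * ((p == k)%:R * x 0 k)
     + 4 / (q * q) * x 0 m * x 0 p * x 0 k ^+ 2).
  by rewrite !frame_transE// !jacE// -/s -/q; field.
have D (j : 'I_4) (F : 'I_4 -> R) : \sum_k (j == k)%:R * F k = F j.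
  rewrite (bigD1 j)//= eqxx mul1r big1 ?addr0// => k /negPf kj.
  by rewrite eq_sym kj mul0r.
under eq_bigr do rewrite E.
rewrite -mulr_sumr big_split /= !sumrB -!mulr_sumr !D -/(sqnorm x) -/q.
rewrite [X in _ * X](_ : _ = (m == p)%:R); last first.
  by rewrite eq_sym; move: (_%:R) => e; field.
have [->|_] := eqVneq m p; first by rewrite sgn_flip2 mul1r.
by rewrite mulr0.
Qed.

End Stereographic.

(** * Clifford algebra and twistor spinors *)

Section Clifford.
Variables (R : realType) (S : spinor_bundle R).
Local Notation V := 'rV[R]_4.
Local Notation C := R[i].
Local Notation gamma := (sp_gamma S).
Implicit Types (c : bool) (x u v : V) (i j k l : 'I_4).

Lemma sum_ord4 (W : nmodType) (F : 'I_4 -> W) : \sum_i F i = F 0 + F 1 + F 2 + F 3.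
Proof.
rewrite !big_ord_recl big_ord0 addr0 !addrA.
by congr (_ + _ + _ + _); congr (F _); apply: val_inj.
Qed.

Lemma sum_delta (W : lmodType C) k (F : 'I_4 -> W) : \sum_i (i == k)%:R *: F i = F k.
Proof.
rewrite (bigD1 k)//= eqxx scale1r big1 ?addr0// => i /negPf ->.
by rewrite scale0r.
Qed.

Lemma gammaCE i j : gamma i *m gamma j = - (gamma j *m gamma i) - (2 * (i == j)%:R) *: 1%:M.
Proof.
have [->|ij] := eqVneq i j; last by rewrite mulr0 scale0r subr0 gammaC.
by rewrite gammaK opprK mulr1 scaler_nat mulr2n opprD addrA subrr sub0r.
Qed.

Lemma sum_gammaK : \sum_i gamma i *m gamma i = - 4 *: 1%:M.
Proof.
rewrite (eq_bigr (fun=> -1%:M)) => [|i _]; last exact: gammaK.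
by rewrite sumr_const card_ord mulNrn scaleNr scaler_nat.
Qed.

(** Two of the e_i commute with e_k . e_l and two anticommute with it, so in
    dimension 4 the four terms cancel. *)
Lemma gamma_sandwich k l : k != l ->
  \sum_i gamma i *m (gamma k *m gamma l) *m gamma i = 0.
Proof.
move=> kl.
have E i : gamma i *m (gamma k *m gamma l) *m gamma i =
    - (gamma k *m gamma l) + (i == k)%:R *: (2 *: (gamma k *m gamma l))
      + (i == l)%:R *: (2 *: (gamma k *m gamma l)).
  have [->|ik] := eqVneq i k.
    rewrite (negPf kl) scale0r addr0 scale1r scaler_nat mulr2n addKr.
    by rewrite mulmxA gammaK mulNmx mul1mx mulNmx [RHS]gammaC.
  rewrite scale0r addr0; have [->|il] := eqVneq i l.
    rewrite scale1r scaler_nat mulr2n addKr -!mulmxA gammaK !mulmxN mulmx1.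
    by rewrite [RHS]gammaC.
  have kiC : gamma k *m gamma i = - (gamma i *m gamma k) by rewrite gammaC// eq_sym.
  have liC : gamma l *m gamma i = - (gamma i *m gamma l) by rewrite gammaC// eq_sym.
  rewrite scale0r addr0 -!mulmxA liC !mulmxN (mulmxA (gamma k) (gamma i)) kiC.
  by rewrite mulNmx mulmxN opprK !mulmxA gammaK mulNmx mul1mx mulNmx.
under eq_bigr do rewrite E.
rewrite 2!big_split /= !sum_delta sumr_const card_ord -addrA -scalerDl -natrD.
by rewrite scaler_nat mulNrn addNr.
Qed.

Local Notation cl x := (cliff_vec gamma x).

Lemma cliff_vecC x i :
  cl x *m gamma i = - (gamma i *m cl x) - (2 * (x 0 i)%:C) *: 1%:M.
Proof.
rewrite /cliff_vec mulmx_suml mulmx_sumr -sumrN.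
rewrite [X in _ - X](_ : _ = \sum_k (k == i)%:R *: ((2 * (x 0 k)%:C) *: 1%:M)).
  rewrite -sumrB; apply: eq_bigr => k _.
  rewrite -scalemxAl -scalemxAr gammaCE scalerBr scalerN !scalerA.
  by congr (_ - _ *: _); rewrite mulrCA mulrA mulrC.
by rewrite sum_delta.
Qed.

(** By [levi_civitaE] the spin connection is a quarter of the commutator of e_i
    with the position vector. *)
Lemma spin_connE c x i :
  spin_conn S c x i = 2^-1 *: (gamma i *m cl x + (x 0 i)%:C *: 1%:M).
Proof.
have -> : spin_conn S c x i = 4^-1 *: (gamma i *m cl x - cl x *m gamma i).
  rewrite /spin_conn.
  rewrite /cliff_vec mulmx_sumr mulmx_suml.
  under eq_bigr => j _ do (under eq_bigr => k _ do rewrite levi_civitaE mulrBr rmorphB scalerBl).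
  under eq_bigr do rewrite sumrB; rewrite sumrB scalerBr; congr (_ - _).
    rewrite (bigD1 i)//= [X in _ + X]big1 ?addr0; last first.
      by move=> j ji; rewrite big1// => k _; rewrite eq_sym (negPf ji) !mulr0 scale0r.
    rewrite scaler_sumr; apply: eq_bigr => k _.
    by rewrite eqxx mulr1 rmorphM -scalerA scalemxAr fmorphV rmorph_nat.
  rewrite scaler_sumr; apply: eq_bigr => j _.
  rewrite (bigD1 i)//= [X in _ + X]big1 ?addr0; last first.
    by move=> k ki; rewrite eq_sym (negPf ki) !mulr0 scale0r.
  by rewrite eqxx mulr1 rmorphM -scalerA scalemxAl fmorphV rmorph_nat.
rewrite cliff_vecC.
have -> (A M : 'M[C]_4) (t : C) : A - (- A - (2 * t) *: M) = 2 *: (A + t *: M).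
  by rewrite opprB opprK scalerDr scalerA scaler_nat mulr2n addrCA addrC.
by rewrite scalerA; congr (_ *: _); field.
Qed.

(** The scalar part of the spin connection drops out of the commutator. Of the
    two remaining products, one contains sum_i e_i . e_i = -4 and the other the
    sandwich of [gamma_sandwich]. *)
Lemma spin_conn_commutator c x k l : k != l ->
  \sum_i gamma i *m (spin_conn S c x i *m (gamma k *m gamma l)
                     - (gamma k *m gamma l) *m spin_conn S c x i) =
  - 2 *: (cl x *m (gamma k *m gamma l)).
Proof.
move=> kl; set G := gamma k *m gamma l; set X := cl x.
have E i : gamma i *m (spin_conn S c x i *m G - G *m spin_conn S c x i) =
    2^-1 *: (gamma i *m gamma i *m (X *m G)) - 2^-1 *: (gamma i *m G *m gamma i *m X).
  have -> : spin_conn S c x i *m G - G *m spin_conn S c x i =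
      2^-1 *: (gamma i *m X *m G - G *m (gamma i *m X)).
    rewrite spin_connE -/X -scalemxAl -scalemxAr -scalerBr mulmxDl mulmxDr.
    by rewrite -scalemxAl -scalemxAr mul1mx mulmx1 opprD addrACA subrr addr0.
  by rewrite -scalemxAr -scalerBr mulmxBr !mulmxA.
under eq_bigr do rewrite E.
rewrite sumrB -!scaler_sumr -!mulmx_suml sum_gammaK gamma_sandwich// mul0mx scaler0 subr0.
by rewrite -scalemxAl mul1mx scalerA; congr (_ *: _); field.
Qed.

(** The spinor is (dx_k /\ dx_l) . psi. The twistor equation reduces the
    derivative of psi to the sandwich of [gamma_sandwich]; the derivative
    2 x_i rho^2 of the weight along e_i then cancels the commutator computed in
    [spin_conn_commutator]. *)
Lemma dirac_coord_2form c (psi : V -> 'cV[C]_4) x k l : k != l ->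
  mdiff psi x -> (forall i, twistor S c psi x i = 0) ->
  Defs.dirac S c (fun z => ((rho z)^+2)%:C *: (gamma k *m gamma l *m psi z)) x = 0.
Proof.
move=> kl pd tw; set G := gamma k *m gamma l; set phi := Defs.dirac S c psi x.
have rr : (fun z : V => rho z ^+ 2) = @rho R * @rho R.
  by apply/funext => z; rewrite expr2.
have rd : cdiff (fun z : V => ((rho z)^+2)%:C) x.
  by apply: cdiff_real; rewrite rr; apply: differentiableM; exact: differentiable_rho.
have Gd : mdiff (fun z => G *m psi z) x by apply: mdiffM => //; exact: mdiff_cst.
have D2 i : dirC (frame i x) (fun z : V => ((rho z)^+2)%:C) x = (2 * (rho x)^+2 * x 0 i)%:C.
  have dr := @diff_derivable _ _ _ _ _ (frame i x) (differentiable_rho x).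
  rewrite dirC_real rr (deriveM dr dr) derive_rho frameE dotZ dot_ebase /GRing.scale /=.
  by congr (_ %:C); ring.
have dpsi i : dir (frame i x) psi x =
    - (4^-1 *: (gamma i *m phi)) - spin_conn S c x i *m psi x.
  by apply/eqP; rewrite eq_sym subr_eq eq_sym -addr_eq0; apply/eqP; exact: tw.
set t := ((rho x) ^+ 2)%:C in D2 *.
have E i : gamma i *m nabla S c i (fun z => ((rho z)^+2)%:C *: (G *m psi z)) x =
    (2 * t) *: (((x 0 i)%:C *: gamma i) *m (G *m psi x))
    - (t / 4) *: (gamma i *m G *m gamma i *m phi)
    + t *: (gamma i *m (spin_conn S c x i *m G - G *m spin_conn S c x i) *m psi x).
  clearbody G; have cd : mdiff (fun=> G) x by exact: mdiff_cst.
  rewrite /nabla (dirZ _ rd Gd) (dirM _ cd pd) dir_cst mul0mx add0r D2 dpsi -/t.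
  set w := spin_conn S c x i.
  have -> : (2 * rho x ^+ 2 * x 0 i)%:C = 2 * t * (x 0 i)%:C.
    by rewrite /t; move: (rho x ^+ 2) => a; rewrite !rmorphM rmorph_nat.
  have -> : G *m (- (4^-1 *: (gamma i *m phi)) - w *m psi x) =
      - (4^-1 *: (G *m gamma i *m phi)) - G *m w *m psi x.
    by rewrite mulmxBr mulmxN -scalemxAr !mulmxA.
  rewrite -scalemxAr -addrA -scalerDr [LHS]mulmxDr -!scalemxAr.
  rewrite -scalemxAl scalerA -[RHS]addrA; congr (_ + _).
  rewrite -addrA [in LHS]mulmxDr scalerDr mulmxN -scalemxAr scalerN scalerA !mulmxA.
  by congr (_ + _ *: _); rewrite -[RHS]mulmxA mulmxBl addrC.
rewrite /Defs.dirac; under eq_bigr do rewrite E.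
rewrite big_split sumrB /= -!scaler_sumr -!mulmx_suml -/(cliff_vec gamma x).
rewrite gamma_sandwich// mul0mx scaler0 subr0 spin_conn_commutator//.
by rewrite -scalemxAl scalerA mulmxA mulrN mulrC scaleNr addrN.
Qed.

End Clifford.

(** * Two-forms acting on spinors *)

Section TwoForms.
Variables (R : realType) (S : spinor_bundle R) (r : nat).
Local Notation V := 'rV[R]_4.
Local Notation C := R[i].
Local Notation gamma := (sp_gamma S).
Implicit Types (i j k l : 'I_4) (b : 'I_4 -> 'I_4 -> 'M[C]_r) (s : 'cV[C]_4).

Lemma rotate_sum3 (W : nmodType) (F : 'I_4 -> 'I_4 -> 'I_4 -> W) :
  \sum_i \sum_k \sum_l F i k l = \sum_i \sum_k \sum_l F l i k.
Proof.
rewrite [RHS](eq_bigr (fun i => \sum_l \sum_k F l i k)) => [|i _]; last exact: exchange_big.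
rewrite [RHS]exchange_big; apply: eq_bigr => i _; apply: eq_bigr => k _ //.
Qed.

(** Up to contractions, cyclic permutations of the indices do not change the
    product of three generators. Contracting it with the cyclic sum of T
    therefore gives three times the sum at stake, plus traces of T. *)
Lemma clifford_cubic s a (T : 'I_4 -> 'I_4 -> 'I_4 -> 'M[C]_r) :
  (forall i k l, T i k l = - T i l k) ->
  (forall i k l, T i k l + T k l i + T l i k = 0) ->
  (forall k, \sum_i T i i k = 0) ->
  \sum_i \sum_k \sum_l (gamma i *m gamma k *m gamma l *m s) a 0 *: T i k l = 0.
Proof.
move=> TA Tcyc Tdiv.
pose P i k l := (gamma i *m gamma k *m gamma l *m s) a 0.
pose Q k := (gamma k *m s) a 0.
pose d i j : C := (i == j)%:R.
have wB (M N : 'M[C]_4) : ((M - N) *m s) a 0 = (M *m s) a 0 - (N *m s) a 0.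
  by rewrite mulmxBl [LHS]mxE; congr (_ + _); rewrite mxE.
have wN (M : 'M[C]_4) : ((- M) *m s) a 0 = - (M *m s) a 0.
  by rewrite mulNmx mxE.
have wZ t (M : 'M[C]_4) : ((t *: M) *m s) a 0 = t * (M *m s) a 0.
  by rewrite -scalemxAl mxE.
have PC i k l : P i k l = - P k i l - 2 * d i k * Q l.
  rewrite /P /Q -wN -wZ -wB; congr ((_ *m s) a 0).
  by rewrite gammaCE mulmxBl mulNmx -scalemxAl mul1mx.
have PC' i k l : P i k l = - P i l k - 2 * d k l * Q i.
  rewrite /P /Q -wN -wZ -wB; congr ((_ *m s) a 0).
  by rewrite -mulmxA gammaCE mulmxBr mulmxN -scalemxAr mulmx1 mulmxA.
have Tii i k : T i k k = 0.
  by have := TA i k k => /eqP; rewrite -addr_eq0 -mulr2n -scaler_nat scaler_eq0 pnatr_eq0 => /eqP.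
have Tdiv' k : \sum_i T i k i = 0.
  by rewrite (eq_bigr (fun i => - T i i k)) ?sumrN ?Tdiv ?oppr0// => i _; exact: TA.
have D1 (F : 'I_4 -> 'M[C]_r) j : \sum_i d i j *: F i = F j by exact: sum_delta.
have dC i j : d i j = d j i by rewrite /d eq_sym.
have cyc i k l : P i k l + P l i k + P k l i =
    3 * P i k l + 2 * d k l * Q i - 4 * (d i l * Q k) + 2 * (d i k * Q l).
  by rewrite (PC l i k) (PC' i l k) (PC' k l i) (PC k i l) (dC k i) (dC l i) (dC l k); ring.
pose Sum (F : 'I_4 -> 'I_4 -> 'I_4 -> C) := \sum_i \sum_k \sum_l F i k l *: T i k l.
have SumE (F G : 'I_4 -> 'I_4 -> 'I_4 -> C) : (forall i k l, F i k l = G i k l) -> Sum F = Sum G.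
  by move=> FG; do 3 apply: eq_bigr => ? _; rewrite FG.
have SumD (F G : 'I_4 -> 'I_4 -> 'I_4 -> C) :
    Sum (fun i k l => F i k l + G i k l) = Sum F + Sum G.
  rewrite /Sum -big_split; apply: eq_bigr => i _; rewrite -big_split; apply: eq_bigr => k _.
  by rewrite -big_split; apply: eq_bigr => l _; exact: scalerDl.
have SumZ t (F : 'I_4 -> 'I_4 -> 'I_4 -> C) : Sum (fun i k l => t * F i k l) = t *: Sum F.
  rewrite /Sum scaler_sumr; apply: eq_bigr => i _; rewrite scaler_sumr; apply: eq_bigr => k _.
  by rewrite scaler_sumr; apply: eq_bigr => l _; rewrite scalerA.
have S0 : Sum P + Sum (fun i k l => P l i k) + Sum (fun i k l => P k l i) = 0.
  rewrite /Sum [X in _ + X + _](rotate_sum3) [X in _ + X + _](rotate_sum3).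
  rewrite [X in _ + X](rotate_sum3) -!big_split.
  apply: big1 => i _; rewrite -!big_split; apply: big1 => k _; rewrite -!big_split.
  by apply: big1 => l _; rewrite /= -!scalerDr Tcyc scaler0.
have SA : Sum (fun i k l => d k l * Q i) = 0.
  apply: big1 => i _; apply: big1 => k _; under eq_bigr => l _ do rewrite dC -scalerA.
  by rewrite D1 Tii scaler0.
have SB : Sum (fun i k l => d i l * Q k) = 0.
  rewrite /Sum; under eq_bigr => i _ do under eq_bigr => k _ do
    (under eq_bigr => l _ do rewrite dC -scalerA; rewrite D1).
  by rewrite exchange_big; apply: big1 => k _; rewrite -scaler_sumr Tdiv' scaler0.
have SC : Sum (fun i k l => d i k * Q l) = 0.
  rewrite /Sum; under eq_bigr => i _ do (rewrite exchange_big /=;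
    under eq_bigr => l _ do (under eq_bigr => k _ do rewrite dC -scalerA; rewrite D1)).
  by rewrite exchange_big; apply: big1 => k _; rewrite -scaler_sumr Tdiv scaler0.
have : 3 *: Sum P = 0.
  move: S0; rewrite -!SumD (SumE _ _ cyc).
  rewrite (SumE _ (fun i k l => 3 * P i k l + 2 * (d k l * Q i) + -4 * (d i l * Q k)
     + 2 * (d i k * Q l))) => [|i k l]; last by ring.
  by rewrite !SumD !SumZ SA SB SC !scaler0 !addr0.
by move=> /eqP; rewrite scaler_eq0 pnatr_eq0 => /eqP.
Qed.

(** Off the diagonal both e_k . e_l and b are antisymmetric, and b vanishes on it. *)
Lemma cliff2E b s a : (forall k l, b k l = - b l k) ->
  cliff2 S b s a = 2^-1 *: \sum_k \sum_l (gamma k *m gamma l *m s) a 0 *: b k l.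
Proof.
move=> bA; pose w k l := (gamma k *m gamma l *m s) a 0.
have bk k : b k k = 0.
  by have := bA k k => /eqP; rewrite -addr_eq0 -mulr2n -scaler_nat scaler_eq0 pnatr_eq0 => /eqP.
have wA k l : k != l -> w k l = - w l k.
  by move=> kl; rewrite /w gammaC// mulNmx mxE.
have E : \sum_k \sum_l w k l *: b k l = 2 *: cliff2 S b s a.
  have T k : \sum_l w k l *: b k l =
      \sum_(l < 4 | (k < l)%N) w k l *: b k l + \sum_(l < 4 | (l < k)%N) w k l *: b k l.
    rewrite (bigID (fun l : 'I_4 => (k < l)%N)) /=; congr (_ + _).
    rewrite (bigD1 k) ?ltnn//= bk scaler0 add0r; apply: eq_bigl => l.
    by rewrite -leqNgt ltn_neqAle andbC.
  under eq_bigr do rewrite T.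
  rewrite big_split /= scaler_nat mulr2n; congr (_ + _).
  rewrite (exchange_big_dep predT) //=; apply: eq_bigr => l _; apply: eq_bigr => k lk.
  by rewrite bA wA ?scalerN ?scaleNr ?opprK// gt_eqF.
by rewrite E scalerA mulVf ?scale1r// pnatr_eq0.
Qed.

End TwoForms.

(** * The Hodge star and negative spinors *)

Section Star.
Variables (R : realType) (r : nat).
Local Notation V := 'rV[R]_4.
Local Notation C := R[i].
Implicit Types (c : bool) (x : V) (i j k l : 'I_4) (b : 'I_4 -> 'I_4 -> 'M[C]_r).

Lemma levi_symbol_swap (t : 4.-tuple 'I_4) (a a' : 'I_4) : a != a' ->
  \det (\matrix_(c < 4) ebase R (tnth t (tperm a a' c))) =
  - \det (\matrix_(c < 4) ebase R (tnth t c)).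
Proof.
move=> aa'.
have -> : \matrix_(c < 4) ebase R (tnth t (tperm a a' c)) =
    row_perm (tperm a a') (\matrix_(c < 4) ebase R (tnth t c)).
  by apply/matrixP => c d; rewrite !mxE.
by rewrite row_permE det_mulmx det_perm odd_tperm aa' mulN1r.
Qed.

Lemma levi_symbol01 i j k l : levi_symbol R j i k l = - levi_symbol R i j k l.
Proof.
rewrite -[RHS](@levi_symbol_swap _ 0 1)//; congr (\det _).
apply/row_matrixP => a; rewrite !rowK; congr (ebase R _).
by case: a => [[|[|[|[|//]]]] ?]; rewrite !(tnth_nth 0) permE.
Qed.

Lemma levi_symbol12 i j k l : levi_symbol R i k j l = - levi_symbol R i j k l.
Proof.
rewrite -[RHS](@levi_symbol_swap _ 1 2)//; congr (\det _).
apply/row_matrixP => a; rewrite !rowK; congr (ebase R _).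
by case: a => [[|[|[|[|//]]]] ?]; rewrite !(tnth_nth 0) permE.
Qed.

Lemma levi_symbol23 i j k l : levi_symbol R i j l k = - levi_symbol R i j k l.
Proof.
rewrite -[RHS](@levi_symbol_swap _ 2 3)//; congr (\det _).
apply/row_matrixP => a; rewrite !rowK; congr (ebase R _).
by case: a => [[|[|[|[|//]]]] ?]; rewrite !(tnth_nth 0) permE.
Qed.

Lemma levi_symbol0123 : levi_symbol R 0 1 2 3 = 1.
Proof.
rewrite /levi_symbol -(det1 R 4); congr (\det _); apply/matrixP => a c; rewrite !mxE.
by case: a c => [[|[|[|[|//]]]] ?] [[|[|[|[|//]]]] ?]; rewrite (tnth_nth 0).
Qed.

Lemma levi_symbol_repeat i j k l : ~~ uniq [:: i; j; k; l] -> levi_symbol R i j k l = 0.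
Proof.
have alt (t : 4.-tuple 'I_4) (a a' : 'I_4) : a != a' -> tnth t a = tnth t a' ->
    \det (\matrix_(c < 4) ebase R (tnth t c)) = 0.
  by move=> aa' e; apply: (determinant_alternate aa') => d; rewrite !mxE e.
rewrite /= !inE !negb_or -!andbA => h; rewrite /levi_symbol.
have [e|ij] := eqVneq i j; first by apply: (alt [tuple i; j; k; l] 0 1).
have [e|ik] := eqVneq i k; first by apply: (alt [tuple i; j; k; l] 0 2).
have [e|il] := eqVneq i l; first by apply: (alt [tuple i; j; k; l] 0 3).
have [e|jk] := eqVneq j k; first by apply: (alt [tuple i; j; k; l] 1 2).
have [e|jl] := eqVneq j l; first by apply: (alt [tuple i; j; k; l] 1 3).
have [e|kl] := eqVneq k l; first by apply: (alt [tuple i; j; k; l] 2 3).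
by move: h; rewrite ij ik il jk jl kl.
Qed.

(** Only the complementary pair of indices contributes to the dual. *)
Lemma star_frame_complement b i j p q : uniq [:: i; j; p; q] ->
  (forall k l, b k l = - b l k) -> star_frame b i j = (levi_symbol R i j p q)%:C *: b p q.
Proof.
move=> u bA.
have all z : z \in [:: i; j; p; q].
  have cE : #|[:: i; j; p; q]| = #|'I_4| by rewrite (card_uniqP u) card_ord.
  by have /(subset_cardP cE) -> : [:: i; j; p; q] \subset 'I_4 by apply/fintype.subsetP.
have pq : p != q by move: u; rewrite /= !inE; case: (p != q); rewrite ?andbF.
pose L k l := (2^-1 * levi_symbol R i j k l)%:C *: b k l.
have L0 k l : (k, l) != (p, q) -> (k, l) != (q, p) -> L k l = 0.
  move=> h1 h2; rewrite /L levi_symbol_repeat ?mulr0 ?scale0r//.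
  apply/negP => /= /and4P[]; rewrite !inE !negb_or => /and3P[ij ik il] /andP[jk jl] kl _.
  have := all k; have := all l; rewrite !inE ![_ == i]eq_sym ![_ == j]eq_sym.
  rewrite (negPf ik) (negPf il) (negPf jk) (negPf jl) /= => /orP[]/eqP el /orP[]/eqP ek.
  - by rewrite ek el eqxx in kl.
  - by rewrite ek el eqxx in h2.
  - by rewrite ek el eqxx in h1.
  - by rewrite ek el eqxx in kl.
rewrite /star_frame (pair_big predT predT L) /= (bigD1 (p, q))//= (bigD1 (q, p))/=; last first.
  by rewrite xpair_eqE negb_and eq_sym pq.
rewrite big1 ?addr0 => [|[k l] /andP[h1 h2]]; last exact: L0.
rewrite /L (levi_symbol23 i j p q) (bA q p) mulrN rmorphN scaleNr scalerN opprK -scalerDl -rmorphD.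
by congr (_%:C *: _); field.
Qed.

Lemma star_frameE b : (forall k l, b k l = - b l k) ->
  [/\ star_frame b 0 1 = b 2 3, star_frame b 0 2 = b 3 1 & star_frame b 0 3 = b 1 2] /\
  [/\ star_frame b 2 3 = b 0 1, star_frame b 3 1 = b 0 2 & star_frame b 1 2 = b 0 3].
Proof.
move=> bA; do 2 split.
- by rewrite (@star_frame_complement b 0 1 2 3)// levi_symbol0123 scale1r.
- rewrite (@star_frame_complement b 0 2 3 1)//.
  by rewrite levi_symbol23 levi_symbol12 levi_symbol0123 opprK scale1r.
- rewrite (@star_frame_complement b 0 3 1 2)//.
  by rewrite levi_symbol12 levi_symbol23 levi_symbol0123 opprK scale1r.
- rewrite (@star_frame_complement b 2 3 0 1)//.
  rewrite levi_symbol12 levi_symbol01 levi_symbol23 levi_symbol12.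
  by rewrite levi_symbol0123 !opprK scale1r.
- rewrite (@star_frame_complement b 3 1 0 2)//.
  rewrite levi_symbol12 levi_symbol01 levi_symbol23 levi_symbol12 levi_symbol23.
  by rewrite levi_symbol12 levi_symbol0123 !opprK scale1r.
- rewrite (@star_frame_complement b 1 2 0 3)//.
  by rewrite levi_symbol12 levi_symbol01 levi_symbol0123 !opprK scale1r.
Qed.

Lemma star_frameA b k l : star_frame b k l = - star_frame b l k.
Proof.
rewrite /star_frame -sumrN; apply: eq_bigr => i _; rewrite -sumrN; apply: eq_bigr => j _.
by rewrite levi_symbol01 mulrN rmorphN scaleNr.
Qed.

Lemma on_frameE (b : form2 R r) x m n : on_frame b x m n = ((rho x) ^+ 2)%:C *: b x m n.
Proof.
have D (F : 'I_4 -> 'M[C]_r) p : \sum_k (p == k)%:R *: F k = F p.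
  by under eq_bigr do rewrite eq_sym; exact: sum_delta.
have E p q : (frame m x 0 p * frame n x 0 q)%:C *: b x p q =
    (m == p)%:R *: ((n == q)%:R *: (((rho x) ^+ 2)%:C *: b x p q)).
  rewrite !frameE !mxE !eqxx /= !scalerA [m == p]eq_sym [n == q]eq_sym; congr (_ *: _).
  rewrite -[(p == m)%:R in RHS](rmorph_nat (real_complex R)).
  rewrite -[(q == n)%:R in RHS](rmorph_nat (real_complex R)) -!rmorphM; congr (_%:C); ring.
rewrite /on_frame; under eq_bigr => p _ do under eq_bigr => q _ do rewrite E.
by under eq_bigr => p _ do rewrite -scaler_sumr D; rewrite D.
Qed.

(** In dimension 4 the Hodge star on 2-forms depends only on the conformal
    class, hence in the chart it is the star of the flat metric. *)
Lemma starE c (b : form2 R r) x k l : star c b x k l = star_frame (b x) k l.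
Proof.
have D (F : 'I_4 -> 'M[C]_r) m : \sum_k (m == k)%:R *: F k = F m.
  by under eq_bigr do rewrite eq_sym; exact: sum_delta.
have cofE m n : coframe c x m (ebase R n) = (n == m)%:R / rho x.
  by rewrite /coframe round_metric_frame mxE eqxx eq_sym.
have sE p q : star_frame (on_frame b x) p q = ((rho x) ^+ 2)%:C *: star_frame (b x) p q.
  rewrite /star_frame scaler_sumr; apply: eq_bigr => m _; rewrite scaler_sumr.
  by apply: eq_bigr => n _; rewrite on_frameE !scalerA mulrC.
have E p q : (coframe c x p (ebase R k) * coframe c x q (ebase R l))%:C *:
     star_frame (on_frame b x) p q =
    (k == p)%:R *: ((l == q)%:R *: star_frame (b x) p q).
  rewrite sE !cofE !scalerA; congr (_ *: _).
  rewrite -[(k == p)%:R in RHS](rmorph_nat (real_complex R)).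
  rewrite -[(l == q)%:R in RHS](rmorph_nat (real_complex R)) -!rmorphM; congr (_%:C).
  by have h := rho_neq0 x; field.
rewrite /star; under eq_bigr => p _ do under eq_bigr => q _ do rewrite E.
by under eq_bigr => p _ do rewrite -scaler_sumr D; rewrite D.
Qed.

End Star.

Section NegativeSpinors.
Variables (R : realType) (S : spinor_bundle R) (r : nat).
Local Notation C := R[i].
Local Notation gamma := (sp_gamma S).
Implicit Types (k l : 'I_4) (b : 'I_4 -> 'I_4 -> 'M[C]_r) (s : 'cV[C]_4).

Lemma cliff2_pairs b s a (w := fun k l => (gamma k *m gamma l *m s) a 0) :
  cliff2 S b s a = w 0 1 *: b 0 1 + w 0 2 *: b 0 2 + w 0 3 *: b 0 3
                 + (w 1 2 *: b 1 2 + w 1 3 *: b 1 3) + w 2 3 *: b 2 3.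
Proof.
rewrite /cliff2; under eq_bigr => k _ do rewrite big_mkcond sum_ord4 /=.
by rewrite sum_ord4 /= !(add0r, addr0).
Qed.

(** Clifford multiplication pairs the six components of a self-dual 2-form into
    the three self-dual combinations that annihilate S^-. *)
Lemma selfdual_cliff2 b s a : (forall k l, b k l = - b l k) -> in_Sminus S s ->
  cliff2 S (fun k l => b k l + star_frame b k l) s a = 0.
Proof.
move=> bA hs; have [[s01 s02 s03] [s23 s31 s12]] := star_frameE bA.
have [h1 h2 h3] := selfdual_act_Sminus hs.
have W (M N : 'M[C]_4) : (M + N) *m s = 0 -> (N *m s) a 0 = - (M *m s) a 0.
  by move=> /matrixP/(_ a 0); rewrite mulmxDl mxE [RHS]mxE => /eqP; rewrite addrC addr_eq0 => /eqP.
have s13 : star_frame b 1 3 = - b 0 2 by rewrite star_frameA s31.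
have w13 : (gamma 1 *m gamma 3 *m s) a 0 = (gamma 0 *m gamma 2 *m s) a 0.
  by rewrite gammaC// mulNmx mxE (W _ _ h2) opprK.
have key (t1 t2 t3 : C) (b1 b2 b3 b4 b5 b6 : 'M[C]_r) :
    t1 *: (b1 + b6) + t2 *: (b2 + b5) + t3 *: (b3 + b4)
    + (- t3 *: (b4 + b3) + t2 *: (- b5 - b2)) + - t1 *: (b6 + b1) = 0.
  rewrite [b4 + b3]addrC [b6 + b1]addrC -opprD [b5 + b2]addrC scalerN !scaleNr.
  move: (t1 *: _) (t2 *: _) (t3 *: _) => A B D.
  by rewrite -opprD [D + B]addrC -(addrA A) addrK subrr.
rewrite cliff2_pairs; apply: etrans (key _ _ _ (b 0 1) (b 0 2) (b 0 3) (b 1 2) (b 3 1) (b 2 3)).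
have add2 (A A' B B' : 'M[C]_r) : A = A' -> B = B' -> A + B = A' + B' by move=> -> ->.
apply: (add2); [apply: (add2); [apply: (add2); [apply: (add2)|]|apply: (add2)]|].
- by rewrite s01.
- by rewrite s02 bA bA.
- by rewrite s03.
- by rewrite s12 (W _ _ h3).
- by rewrite s13 w13 (bA 1 3).
- by rewrite s23 (W _ _ h1).
Qed.

Lemma cliff2D b b' s a :
  cliff2 S (fun k l => b k l + b' k l) s a = cliff2 S b s a + cliff2 S b' s a.
Proof.
rewrite /cliff2 -big_split; apply: eq_bigr => k _; rewrite -big_split.
by apply: eq_bigr => l _; exact: scalerDr.
Qed.

Lemma cliff2Z (t : C) b s a : cliff2 S (fun k l => t *: b k l) s a = t *: cliff2 S b s a.
Proof.
rewrite /cliff2 scaler_sumr; apply: eq_bigr => k _; rewrite scaler_sumr.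
by apply: eq_bigr => l _; rewrite !scalerA mulrC.
Qed.

Lemma cliff2_ext b b' s a : (forall k l, b k l = b' k l) -> cliff2 S b s a = cliff2 S b' s a.
Proof. by move=> bb'; apply: eq_bigr => k _; apply: eq_bigr => l _; rewrite bb'. Qed.

(** On S^- the self-dual part of a 2-form acts trivially, so the anti-self-dual
    part can be replaced by the whole form. *)
Lemma asd_cliff2 c (F : form2 R r) x s a : (forall k l, F x k l = - F x l k) ->
  in_Sminus S s ->
  cliff2 S (on_frame (asd_part c F) x) s a =
  2^-1 *: \sum_k \sum_l (((rho x) ^+ 2)%:C * (gamma k *m gamma l *m s) a 0) *: F x k l.
Proof.
move=> FA hs.
have E k l : on_frame (asd_part c F) x k l =
    ((rho x) ^+ 2)%:C *: F x k l
    + (- (((rho x) ^+ 2)%:C / 2)) *: (F x k l + star_frame (F x) k l).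
  rewrite on_frameE /asd_part starE; apply/matrixP => i j; rewrite !mxE.
  by field.
rewrite (cliff2_ext _ _ E) cliff2D !cliff2Z selfdual_cliff2// scaler0 addr0 cliff2E//.
rewrite scalerA mulrC -scalerA; congr (_ *: _); rewrite scaler_sumr; apply: eq_bigr => k _.
by rewrite scaler_sumr; apply: eq_bigr => l _; rewrite scalerA.
Qed.

End NegativeSpinors.

(** * Curvature *)

(** A, p and q are to be read as a connection form and its first and second
    derivatives, F as its curvature and D as the covariant derivative of F. The
    additive map e, an entry of a matrix later on, moves the noncommutative
    identity to a commutative ring, its atoms being the images of monomials. *)
Lemma bianchi_algebra (T : pzRingType) (K : comPzRingType) (e : T -> K)
    (eD : forall u v, e (u + v) = e u + e v) (eN : forall u, e (- u) = - e u)
    (A : 'I_4 -> T) (p : 'I_4 -> 'I_4 -> T) (q : 'I_4 -> 'I_4 -> 'I_4 -> T)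
    (qC : forall i k l, q i k l = q k i l)
    (F := fun k l => (p k l + A k * A l) - (p l k + A l * A k))
    (D := fun i k l => (q i k l + (p i k * A l + A k * p i l))
       - (q i l k + (p i l * A k + A l * p i k)) + (A i * F k l - F k l * A i)) k l m :
  e (D k l m + D l m k + D m k l) = 0.
Proof.
rewrite /D /F (qC l m k) (qC m k l) (qC l k m).
by rewrite !(mulrDl, mulrDr, mulNr, mulrN) !mulrA !(eD, eN); ring.
Qed.

Section Curvature.
Variables (R : realType) (r : nat).
Local Notation V := 'rV[R]_4.
Local Notation C := R[i].
Local Notation M := 'M[C]_r.
Implicit Types (c : bool) (x : V) (i j k l m : 'I_4) (a b : form1 R r) (U : set V).

(** The covariant derivative on End E-valued 2-forms for the flat metric of the
    chart. *)
Definition cov a (b : form2 R r) x i k l : M :=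
  partial i (fun z => b z k l) x + (a x i *m b x k l - b x k l *m a x i).

Lemma curvatureE a x k l : curvature a x k l =
  (partial k (fun z => a z l) x + a x k *m a x l)
  - (partial l (fun z => a z k) x + a x l *m a x k).
Proof.
rewrite /curvature (_ : dA0 a _ = a)//; apply/funext => z; apply/funext => n.
by rewrite /dA0 /partial dir_cst add0r mulmx1.
Qed.

Lemma curvatureA a x k l : curvature a x k l = - curvature a x l k.
Proof. by rewrite !curvatureE opprB. Qed.

Lemma smooth_curvature U a k l : open U -> (forall n, smooth_mx U (fun x => a x n)) ->
  smooth_mx U (fun x => curvature a x k l).
Proof.
move=> oU aS; have S n p : smooth_mx U (fun x => partial n (fun z => a z p) x + a x n *m a x p).
  by apply: smooth_mxD => //; [exact: smooth_mx_partial|exact: smooth_mxM].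
under eq_fun do rewrite curvatureE.
by apply: smooth_mxD => //; exact: smooth_mxN.
Qed.

Lemma bianchi U a x k l m : open U -> (forall n, smooth_mx U (fun x => a x n)) -> U x ->
  cov a (curvature a) x k l m + cov a (curvature a) x l m k + cov a (curvature a) x m k l = 0.
Proof.
move=> oU aS Ux.
have ad n : mdiff (fun z => a z n) x by exact: smooth_mx_mdiff (aS n) Ux.
have pd n p : mdiff (fun z => partial n (fun z => a z p) z) x.
  by apply: (@smooth_mx_mdiff _ U) => //; exact: smooth_mx_partial.
pose p n p := partial n (fun z => a z p) x.
pose q n p s := partial n (partial p (fun z => a z s)) x.
have covE n p' s : cov a (curvature a) x n p' s =
   (q n p' s + (p n p' *m a x s + a x p' *m p n s))
       - (q n s p' + (p n s *m a x p' + a x s *m p n p'))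
   + (a x n *m ((p p' s + a x p' *m a x s) - (p s p' + a x s *m a x p'))
   - ((p p' s + a x p' *m a x s) - (p s p' + a x s *m a x p')) *m a x n).
  rewrite /cov curvatureE; congr (_ + _).
  under eq_fun do rewrite curvatureE.
  have pad u w : mdiff (fun z => partial u (fun z => a z w) z + a z u *m a z w) x.
    by apply: mdiffD => //; exact: mdiffM.
  rewrite /partial (dirD _ (pad _ _) (mdiffN (pad _ _))) (dirN _ (pad _ _)).
  have E u w : dir (ebase R n) (fun z => partial u (fun z => a z w) z + a z u *m a z w) x =
    q n u w + (p n u *m a x w + a x u *m p n w).
    by rewrite (dirD _ (pd u w) (mdiffM (ad u) (ad w))) (dirM _ (ad u) (ad w)).
  by congr (_ - _); exact: E.
rewrite !covE; apply/matrixP => i j; rewrite [RHS]mxE.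
apply: (@bianchi_algebra 'M[C]_r C (fun B => B i j) _ _ (a x) p q).
- by move=> u v; exact: mxE.
- by move=> u; exact: mxE.
- by move=> n p' s; exact: (partial_comm oU n p' (aS s) Ux).
Qed.

Lemma cov_antisym a (b : form2 R r) x i k l : (forall z k l, b z k l = - b z l k) ->
  mdiff (fun z => b z l k) x -> cov a b x i k l = - cov a b x i l k.
Proof.
move=> bA bd; rewrite /cov; have -> : (fun z => b z k l) = (fun z => - b z l k).
  by apply/funext => z; exact: bA.
by rewrite /partial dirN// (bA x k l) mulmxN mulNmx !opprD !opprK.
Qed.

(** The component of d_A(star F) on the three coordinates other than m is, up
    to sign, the component m of the divergence of F. *)
Lemma yang_mills_divergence c a x m : (forall k l, mdiff (fun z => curvature a z k l) x) ->
  (forall k l n, dA2_End a (star c (curvature a)) x k l n = 0) ->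
  \sum_i cov a (curvature a) x i i m = 0.
Proof.
set F := curvature a; move=> Fd ym.
have FA z k l : F z k l = - F z l k by exact: curvatureA.
have FD i k l : cov a F x i k l = - cov a F x i l k by exact: cov_antisym.
have F0 i k : cov a F x i k k = 0.
  by have := FD i k k => /eqP; rewrite -addr_eq0 -mulr2n -scaler_nat scaler_eq0 pnatr_eq0 => /eqP.
pose sF : form2 R r := star c F.
have ymE k l n : cov a sF x k l n + cov a sF x l n k + cov a sF x n k l = 0.
  exact: ym.
have covS k l p q i : (forall z, sF z k l = F z p q) -> cov a sF x i k l = cov a F x i p q.
  move=> E; rewrite /cov E; congr (_ + _).
  by congr (partial i _ x); apply/funext => z; exact: E.
have st z := star_frameE (FA z).
have s01 z : sF z 0 1 = F z 2 3 by rewrite /sF starE; have [[]] := st z.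
have s02 z : sF z 0 2 = F z 3 1 by rewrite /sF starE; have [[]] := st z.
have s03 z : sF z 0 3 = F z 1 2 by rewrite /sF starE; have [[]] := st z.
have s23 z : sF z 2 3 = F z 0 1 by rewrite /sF starE; have [_ []] := st z.
have s31 z : sF z 3 1 = F z 0 2 by rewrite /sF starE; have [_ []] := st z.
have s12 z : sF z 1 2 = F z 0 3 by rewrite /sF starE; have [_ []] := st z.
have sA z k l : sF z k l = - sF z l k by rewrite /sF !starE star_frameA.
have s20 z : sF z 2 0 = F z 1 3 by rewrite sA s02 (FA z 1 3).
have s30 z : sF z 3 0 = F z 2 1 by rewrite sA s03 (FA z 2 1).
have s13 z : sF z 1 3 = F z 2 0 by rewrite sA s31 (FA z 2 0).
rewrite sum_ord4; case: m => [[|[|[|[|//]]]] mlt].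
- have <- : 0 = Ordinal mlt :> 'I_4 by exact: val_inj.
  rewrite F0 add0r (FD 1) (FD 2) (FD 3).
  have := ymE 1 2 3; rewrite (covS _ _ _ _ 1 s23) (covS _ _ _ _ 2 s31) (covS _ _ _ _ 3 s12).
  by rewrite -!opprD => ->; rewrite oppr0.
- have <- : 1 = Ordinal mlt :> 'I_4 by exact: val_inj.
  rewrite F0 addr0.
  have := ymE 0 2 3; rewrite (covS _ _ _ _ 0 s23) (covS _ _ _ _ 2 s30) (covS _ _ _ _ 3 s02).
  by [].
- have <- : 2 = Ordinal mlt :> 'I_4 by exact: val_inj.
  rewrite F0 addr0 (FD 0) (FD 1) (FD 3).
  have := ymE 0 1 3; rewrite (covS _ _ _ _ 0 s13) (covS _ _ _ _ 1 s30) (covS _ _ _ _ 3 s01).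
  by rewrite -!opprD => ->; rewrite oppr0.
- have <- : 3 = Ordinal mlt :> 'I_4 by exact: val_inj.
  rewrite F0 addr0.
  have := ymE 0 1 2; rewrite (covS _ _ _ _ 0 s12) (covS _ _ _ _ 1 s20) (covS _ _ _ _ 2 s01).
  by [].
Qed.

End Curvature.

(** * Change of frame and of chart *)

(** G is a change of frame, d and h its first and second derivatives, and
    - G' d G' the derivative of its inverse G'. The expression P k l is the sum
    of the derivative of the new connection form and of its square; the terms
    that do not appear on the right are symmetric in k and l. *)
Lemma gauge_algebra (T : pzRingType) (K : comPzRingType) (e : T -> K)
    (eD : forall u v, e (u + v) = e u + e v) (eN : forall u, e (- u) = - e u)
    (G G' : T) (GG : G * G' = 1) (A d : 'I_4 -> T) (p h : 'I_4 -> 'I_4 -> T)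
    (hC : forall k l, h k l = h l k)
    (P := fun k l => ((- (G' * d k * G') * A l + G' * p k l) * G + G' * A l * d k)
       + (- (G' * d k * G') * d l + G' * h k l)
       + (G' * A k * G + G' * d k) * (G' * A l * G + G' * d l)) k l :
  e (P k l - P l k) = e (G' * ((p k l + A k * A l) - (p l k + A l * A k)) * G).
Proof.
have GK u : u * G * G' = u by rewrite -mulrA GG mulr1.
by rewrite /P (hC l k) !(mulrDl, mulrDr, mulNr, mulrN) !mulrA !GK !(eD, eN); ring.
Qed.

Section ChangeOfFrame.
Variables (R : realType) (r : nat).
Local Notation V := 'rV[R]_4.
Local Notation C := R[i].
Local Notation M := 'M[C]_r.
Implicit Types (x : V) (k l m n : 'I_4) (a b : form1 R r) (U : set V).

Lemma curvature_gauge U a b (g g' : V -> M) x k l : open U ->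
  (forall n, smooth_mx U (fun z => a z n)) -> smooth_mx U g -> smooth_mx U g' ->
  (forall z, U z -> g' z *m g z = 1%:M) -> (forall z, U z -> g z *m g' z = 1%:M) ->
  (forall z n, U z -> b z n = g' z *m a z n *m g z + g' z *m partial n g z) ->
  U x -> curvature b x k l = g' x *m curvature a x k l *m g x.
Proof.
move=> oU aS gS gS' g'g gg' bE Ux.
have nU : \near x, U x by exact: open_nbhs_nbhs.
have gd : mdiff g x by exact: smooth_mx_mdiff gS Ux.
have gd' : mdiff g' x by exact: smooth_mx_mdiff gS' Ux.
have ad n : mdiff (fun z => a z n) x by exact: smooth_mx_mdiff (aS n) Ux.
have pgd n : mdiff (partial n g) x.
  by apply: (@smooth_mx_mdiff _ U) => //; exact: smooth_mx_partial.
have dg' n : partial n g' x = - (g' x *m partial n g x *m g' x).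
  have : dir (ebase R n) (fun z => g' z *m g z) x = 0.
    rewrite (@eq_dir _ _ _ _ _ _ (fun=> 1%:M)) ?dir_cst//.
    by apply: filterS nU => z; exact: g'g.
  rewrite dirM// => /eqP; rewrite addr_eq0 => /eqP/(f_equal (mulmx^~ (g' x))).
  by rewrite mulNmx -mulmxA gg'// mulmx1.
have pb n s : partial n (fun z => b z s) x =
    ((- (g' x *m partial n g x *m g' x) *m a x s + g' x *m partial n (fun z => a z s) x) *m g x
      + g' x *m a x s *m partial n g x)
    + (- (g' x *m partial n g x *m g' x) *m partial s g x + g' x *m partial n (partial s g) x).
  transitivity (partial n (fun z => g' z *m a z s *m g z + g' z *m partial s g z) x).
    by apply: eq_dir; apply: filterS nU => z; exact: bE.
  rewrite -dg' /partial (dirD _ (mdiffM (mdiffM gd' (ad s)) gd) (mdiffM gd' (pgd s))).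
  by rewrite (dirM _ (mdiffM gd' (ad s)) gd) (dirM _ gd' (ad s)) (dirM _ gd' (pgd s)).
rewrite !curvatureE !pb !bE//.
apply/matrixP => i j.
apply: (@gauge_algebra 'M[C]_r C (fun B => B i j) _ _ (g x) (g' x) (gg' x Ux) (a x)
  (fun n => partial n g x) (fun n s => partial n (fun z => a z s) x)
  (fun n s => partial n (partial s g) x)).
- by move=> u v; exact: mxE.
- by move=> u; exact: mxE.
- by move=> n s; exact: (partial_comm oU n s gS Ux).
Qed.

(** The second derivatives of the change of coordinates that appear in the
    derivative of the pulled back connection form are symmetric, and disappear
    by antisymmetrization. *)
Lemma curvature_pullback a b x k l : x != 0 ->
  (\near x, forall n, b x n = \sum_m (jac x m n)%:C *: a (trans x) m) ->
  (forall n, mdiff (fun z => a z n) (trans x)) ->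
  curvature b x k l =
  \sum_m \sum_n (jac x m k * jac x n l)%:C *: curvature a (trans x) m n.
Proof.
move=> x0 nb ad.
have td m : differentiable (fun z : V => trans z 0 m) x by exact: differentiable_trans.
have jd m n : cdiff (fun z => (jac z m n)%:C) x by exact/cdiff_real/differentiable_jac.
have atd m : mdiff (fun z => a (trans z) m) x.
  exact: (@mdiff_comp _ _ _ _ (fun y => a y m) (@trans R) td (ad m)).
pose J m n : C := (jac x m n)%:C.
pose p m n := partial m (fun z => a z n) (trans x).
have bx n : b x n = \sum_m J m n *: a (trans x) m by have := nbhs_singleton nb; exact.
have pb s t : partial s (fun z => b z t) x =
    \sum_n ('D_(ebase R s) (fun z => jac z n t) x)%:C *: a (trans x) n
    + \sum_n \sum_m (J m s * J n t) *: p m n.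
  transitivity (partial s (fun z => \sum_n (jac z n t)%:C *: a (trans z) n) x).
    by apply: eq_dir; apply: filterS nb => z; exact.
  rewrite /partial dir_sum => [|n]; last exact: mdiffZ.
  rewrite -big_split; apply: eq_bigr => n _.
  rewrite dirZ// dirC_real; congr (_ + _).
  rewrite (@dir_comp _ _ _ _ _ (fun y => a y n) (@trans R) td (ad n)) scaler_sumr.
  by apply: eq_bigr => m _; rewrite scalerA mulrC.
have bb s t : b x s *m b x t = \sum_n \sum_m (J m s * J n t) *: (a (trans x) m *m a (trans x) n).
  rewrite !bx mulmx_suml [RHS]exchange_big; apply: eq_bigr => m _; rewrite mulmx_sumr.
  by apply: eq_bigr => n _; rewrite -scalemxAl -scalemxAr scalerA.
pose X m n := p m n + a (trans x) m *m a (trans x) n.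
pose Q s t := \sum_n \sum_m (J m s * J n t) *: X m n.
pose D s t := \sum_n ('D_(ebase R s) (fun z => jac z n t) x)%:C *: a (trans x) n.
have PE s t : partial s (fun z => b z t) x + b x s *m b x t = D s t + Q s t.
  rewrite pb bb -addrA; congr (_ + _); rewrite -big_split; apply: eq_bigr => n _.
  by rewrite -big_split; apply: eq_bigr => m _; rewrite /= -scalerDr.
have DC : D l k = D k l.
  apply: eq_bigr => n _.
  exact: (f_equal (fun t : R => t%:C *: a (trans x) n) (jac_comm n l k x0)).
rewrite curvatureE !PE DC opprD addrACA subrr add0r /Q [X in _ - X]exchange_big.
rewrite [RHS]exchange_big -sumrB; apply: eq_bigr => n _; rewrite -sumrB.
apply: eq_bigr => m _; rewrite mulrC -scalerBr curvatureE.
by rewrite mulrC rmorphM.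
Qed.

End ChangeOfFrame.

(** * The section given by the curvature and a twistor spinor *)

(** Rotating both the spinor coefficients w and the components B of a 2-form
    leaves their contraction unchanged. *)
Lemma orthogonal_change (K : comPzRingType) (W : lmodType K) (L w : 'I_4 -> 'I_4 -> K)
    (B : 'I_4 -> 'I_4 -> W) (t : K) :
  (forall m p, \sum_k L m k * L p k = (m == p)%:R) ->
  \sum_k \sum_l \sum_p \sum_q
     (\sum_m \sum_n (L m k * L n l * w m n)) *: ((t * L p k * L q l) *: B p q)
  = \sum_p \sum_q (t * w p q) *: B p q.
Proof.
move=> LL; under eq_bigr => k _ do under eq_bigr => l _ do rewrite pair_big /=.
rewrite pair_big /= exchange_big /= [RHS]pair_big /=; apply: eq_bigr => -[p q] _ /=.
under eq_bigr do rewrite scalerA; rewrite -scaler_suml; congr (_ *: _).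
rewrite -(pair_big predT predT (fun k l => (\sum_m \sum_n L m k * L n l * w m n) * (t * L p k * L q l))) /=.
transitivity (\sum_m \sum_n (t * w m n) * ((\sum_k L m k * L p k) * (\sum_l L n l * L q l))).
  under [RHS]eq_bigr => m _ do under eq_bigr => n _ do rewrite big_distrlr /= mulr_sumr.
  under [RHS]eq_bigr => m _ do rewrite exchange_big /=.
  rewrite [RHS]exchange_big; apply: eq_bigr => k _.
  under [RHS]eq_bigr => m _ do under eq_bigr => n _ do rewrite mulr_sumr.
  under [RHS]eq_bigr => m _ do rewrite exchange_big /=.
  rewrite [RHS]exchange_big; apply: eq_bigr => l _ /=.
  rewrite mulr_suml; apply: eq_bigr => m _; rewrite mulr_suml; apply: eq_bigr => n _; ring.
rewrite (bigD1 p)//= [X in _ + X]big1 ?addr0 => [|m /negPf mp]; last first.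
  by rewrite big1// => n _; rewrite LL mp mul0r mulr0.
rewrite (bigD1 q)//= [X in _ + X]big1 ?addr0 => [|n /negPf nq]; last first.
  by rewrite !LL nq !mulr0.
by rewrite !LL !eqxx !mulr1.
Qed.

Section CurvatureAction.
Variables (R : realType) (S : spinor_bundle R) (r : nat).
Variables (E : vector_bundle R r) (A : connection E).
Variable psi : bool -> 'rV[R]_4 -> 'cV[R[i]]_4.
Hypothesis hYM : yang_mills A.
Hypothesis hpsi : spinor_section S psi.
Hypothesis hminus : forall c x, in_Sminus S (psi c x).
Hypothesis htwistor : forall c x k, twistor S c (psi c) x k = 0.
Local Notation V := 'rV[R]_4.
Local Notation C := R[i].
Local Notation gamma := (sp_gamma S).
Implicit Types (i j : vb_idx E) (c : bool) (x : V) (a k l m n : 'I_4).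

Local Notation F i c := (curvature (cn_form A i c)).

(** The action of dx_k /\ dx_l on psi. *)
Definition dx2_act c k l (z : V) : 'cV[C]_4 :=
  ((rho z) ^+ 2)%:C *: (gamma k *m gamma l *m psi c z).

Lemma Fminus_actE i c x a : Fminus_act A S psi i c x a =
  2^-1 *: \sum_k \sum_l (dx2_act c k l x) a 0 *: F i c x k l.
Proof.
rewrite /Fminus_act /Fminus asd_cliff2//; last by move=> k l; exact: curvatureA.
by congr (_ *: _); apply: eq_bigr => k _; apply: eq_bigr => l _; rewrite [in RHS]mxE.
Qed.

Lemma curvature_diag i c x k : F i c x k k = 0.
Proof.
have := curvatureA (cn_form A i c) x k k => /eqP.
by rewrite -addr_eq0 -mulr2n -scaler_nat scaler_eq0 pnatr_eq0 => /eqP.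
Qed.

Lemma act_spin_sum (M : 'M[C]_4) (s : 'I_4 -> 'I_4 -> 'cV[C]_4) (B : 'I_4 -> 'I_4 -> 'M[C]_r) a :
  act_spin M (fun b => 2^-1 *: \sum_k \sum_l (s k l) b 0 *: B k l) a =
  2^-1 *: \sum_k \sum_l (M *m s k l) a 0 *: B k l.
Proof.
rewrite /act_spin; under eq_bigr => b _ do rewrite scalerA mulrC -scalerA scaler_sumr.
rewrite -scaler_sumr exchange_big; congr (_ *: _); apply: eq_bigr => k _.
under eq_bigr => b _ do rewrite scaler_sumr.
rewrite exchange_big; apply: eq_bigr => l _.
by rewrite mxE scaler_suml; apply: eq_bigr => b _; rewrite scalerA.
Qed.

Lemma cn_smooth_dom i c n : smooth_mx (dom i c) (fun x => cn_form A i c x n).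
Proof. exact: cn_smooth. Qed.

Lemma smooth_curvature_dom i c k l : smooth_mx (dom i c) (fun x => F i c x k l).
Proof. by apply: smooth_curvature; [exact: open_dom|exact: cn_smooth]. Qed.

Lemma smooth_dx2_act c k l (U : set V) : open U -> smooth_mx U (dx2_act c k l).
Proof.
move=> oU; apply: smooth_mxZ => //.
  apply: csmooth_real; under eq_fun do rewrite expr2.
  by apply: smoothM => //; exact: smooth_rho.
apply: smooth_mxM => //; first exact: smooth_mx_cst.
by apply: smooth_mx_subset (hpsi.1 c).
Qed.

Lemma Fminus_act_smooth i c a : smooth_mx (dom i c) (fun x => Fminus_act A S psi i c x a).
Proof.
have oU := @open_dom R r E i c; under eq_fun do rewrite Fminus_actE.
apply: smooth_mxZ => //; first exact: csmooth_cst.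
apply: smooth_mx_sum => // k; apply: smooth_mx_sum => // l.
by apply: smooth_mxZ => //; [exact: (smooth_dx2_act c k l oU a 0)|exact: smooth_curvature_dom].
Qed.

(** e_k anticommutes with three of the four factors of the volume form. *)
Lemma gamma_vol k : vol S *m gamma k = - (gamma k *m vol S).
Proof.
pose ep (j : 'I_4) : C := if j == k then 1 else -1.
have G (j : 'I_4) : gamma j *m gamma k = ep j *: (gamma k *m gamma j).
  rewrite /ep; case: eqVneq => [->|jk]; first by rewrite scale1r.
  by rewrite scaleN1r gammaC.
rewrite /vol -!mulmxA G -!scalemxAr (mulmxA (gamma 2) (gamma k)) G -!scalemxAl -!scalemxAr.
rewrite -(mulmxA (gamma k)) (mulmxA (gamma 1) (gamma k)) G -!scalemxAl -!scalemxAr.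
rewrite -(mulmxA (gamma k)) (mulmxA (gamma 0) (gamma k)) G -!scalemxAl -!mulmxA !scalerA.
rewrite -scaleN1r; congr (_ *: _); rewrite /ep.
by case: k {ep G} => [[|[|[|[|//]]]] ?] /=; rewrite ?(mulrNN, mulrN1, mulr1, opprK).
Qed.

Lemma Fminus_act_minus i c x : in_Sminus_End S (Fminus_act A S psi i c x).
Proof.
move=> a.
have -> : Fminus_act A S psi i c x =
    fun b => 2^-1 *: \sum_k \sum_l (dx2_act c k l x) b 0 *: F i c x k l.
  by apply/funext => b; exact: Fminus_actE.
rewrite act_spin_sum; congr (_ *: _); apply: eq_bigr => k _; apply: eq_bigr => l _.
have vkl : vol S *m (gamma k *m gamma l) = gamma k *m gamma l *m vol S.
  by rewrite mulmxA gamma_vol mulNmx -(mulmxA _ (vol S)) gamma_vol mulmxN opprK mulmxA.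
have -> : vol S *m dx2_act c k l x = dx2_act c k l x; last by [].
by rewrite /dx2_act -scalemxAr mulmxA vkl -(mulmxA _ (vol S)) (hminus c x).
Qed.

Lemma Fminus_act_gauge i j c x a : dom i c x -> dom j c x ->
  Fminus_act A S psi j c x a =
  vb_trans j i (stereo c x) *m Fminus_act A S psi i c x a *m vb_trans i j (stereo c x).
Proof.
move=> dix djx.
pose U : set V := [set z | vb_dom i (stereo c z) /\ vb_dom j (stereo c z)].
have oU : open U by exact: (openI (@open_dom R r E i c) (@open_dom R r E j c)).
have UE k l : F j c x k l = vb_trans j i (stereo c x) *m F i c x k l *m vb_trans i j (stereo c x).
  apply: (@curvature_gauge R r U (cn_form A i c) (cn_form A j c)
     (fun z => vb_trans i j (stereo c z)) (fun z => vb_trans j i (stereo c z))) => //.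
  - by move=> n; apply: smooth_mx_subset (cn_smooth_dom i c n) => z [].
  - exact: vb_smooth.
  - by apply: smooth_mx_subset (@vb_smooth _ _ E j i c) => z [].
  - by move=> z [zi zj]; rewrite vb_cocycle ?vb_trans_id//; exact: stereo_sphere4.
  - by move=> z [zi zj]; rewrite vb_cocycle ?vb_trans_id//; exact: stereo_sphere4.
  - by move=> z n [zi zj]; exact: cn_gauge.
rewrite !Fminus_actE -scalemxAr -scalemxAl; congr (_ *: _).
rewrite mulmx_sumr mulmx_suml; apply: eq_bigr => k _.
rewrite mulmx_sumr mulmx_suml; apply: eq_bigr => l _.
by rewrite UE -scalemxAr -scalemxAl.
Qed.

Lemma near_cn_coord i x : x != 0 -> dom i false x ->
  \near x, forall n, cn_form A i false x n = \sum_m (jac x m n)%:C *: cn_form A i true (trans x) m.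
Proof.
move=> x0 xi.
have oU : open ([set z : V | z != 0] `&` dom i false).
  by apply: openI; [exact: open_neq0|exact: open_dom].
apply: filterS (open_nbhs_nbhs (conj oU (conj x0 xi))) => z [z0 zi] n.
exact: cn_coord.
Qed.

Lemma curvature_chart i x k l : x != 0 -> dom i false x ->
  F i false x k l =
  \sum_m \sum_n (jac x m k * jac x n l)%:C *: F i true (trans x) m n.
Proof.
move=> x0 xi; apply: curvature_pullback => //; first exact: near_cn_coord.
move=> n; apply: (smooth_mx_mdiff (cn_smooth_dom i true n)).
by rewrite /dom /= stereo_trans.
Qed.

(** Moving the spin lift of the change of frame past a generator rotates the
    generator. *)
Lemma sp_trans_gamma2 x k l (s : 'cV[C]_4) a : x != 0 ->
  (sp_trans S x *m (gamma k *m gamma l *m s)) a 0 =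
  \sum_m \sum_n (frame_trans x m k * frame_trans x n l)%:C
     * (gamma m *m gamma n *m (sp_trans S x *m s)) a 0.
Proof.
move=> x0; set h := sp_trans S x.
have lift n : h *m gamma n = \sum_m (frame_trans x m n)%:C *: (gamma m *m h).
  rewrite (sp_lift S n x0) mulmx_suml; apply: eq_bigr => m _.
  by rewrite -scalemxAl.
have -> : h *m (gamma k *m gamma l *m s) =
   \sum_m \sum_n (frame_trans x m k * frame_trans x n l)%:C *: (gamma m *m gamma n *m (h *m s)).
  rewrite !mulmxA lift !mulmx_suml; apply: eq_bigr => m _.
  rewrite -!scalemxAl -(mulmxA _ h) lift mulmx_sumr mulmx_suml scaler_sumr.
  apply: eq_bigr => n _; rewrite -scalemxAr -scalemxAl scalerA -rmorphM.
  by rewrite !mulmxA.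
by rewrite summxE; apply: eq_bigr => m _; rewrite summxE; apply: eq_bigr => n _; rewrite mxE.
Qed.

(** The change of frame rotates the components of F on the orthonormal frame and
    its spin lift rotates the Clifford generators; both rotations cancel. *)
Lemma Fminus_act_trans i x a : x != 0 -> dom i false x ->
  Fminus_act A S psi i true (trans x) a =
  act_spin (sp_trans S x) (Fminus_act A S psi i false x) a.
Proof.
move=> x0 xi; set h := sp_trans S x.
have -> : Fminus_act A S psi i false x =
    fun b => 2^-1 *: \sum_k \sum_l (dx2_act false k l x) b 0 *: F i false x k l.
  by apply/funext => b; exact: Fminus_actE.
rewrite act_spin_sum [LHS]Fminus_actE; apply: (f_equal (fun X => 2^-1 *: X)).
pose w m n := (gamma m *m gamma n *m (h *m psi false x)) a 0.
pose L m n : C := (frame_trans x m n)%:C.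
pose t : C := ((rho (trans x))^+2)%:C.
pose B m n := F i true (trans x) m n.
have LL m p : \sum_k L m k * L p k = (m == p)%:R.
  rewrite -[RHS](rmorph_nat (real_complex R)) -(frame_trans_orthogonal m p x0) rmorph_sum.
  by apply: eq_bigr => k _; rewrite rmorphM.
have lhs k l : (dx2_act true k l (trans x)) a 0 = t * w k l.
  by rewrite /dx2_act hpsi.2// mxE.
have rhs k l : (h *m dx2_act false k l x) a 0 *: F i false x k l =
    \sum_p \sum_q (\sum_m \sum_n (L m k * L n l * w m n)) *: ((t * L p k * L q l) *: B p q).
  rewrite /dx2_act -scalemxAr mxE sp_trans_gamma2// curvature_chart// mulrC -scalerA scaler_sumr.
  rewrite [X in _ = X](_ : _ = (\sum_m \sum_n (L m k * L n l * w m n)) *: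
    \sum_p \sum_q (t * L p k * L q l) *: B p q); last first.
    by rewrite scaler_sumr; apply: eq_bigr => p _; rewrite scaler_sumr.
  congr (_ *: _).
    by apply: eq_bigr => m _; apply: eq_bigr => n _; rewrite rmorphM.
  apply: eq_bigr => p _; rewrite scaler_sumr; apply: eq_bigr => q _.
  rewrite scalerA; congr (_ *: _); rewrite /t /L !frame_transE// rho_trans//.
  rewrite -!rmorphM; congr (_%:C).
  by have q0 : sqnorm x != 0; [rewrite sqnorm_eq0|field].
transitivity (\sum_k \sum_l (t * w k l) *: B k l).
  apply: eq_bigr => k _; apply: eq_bigr => l _.
  exact: (f_equal (fun X => X *: _) (lhs k l)).
symmetry; apply: etrans (orthogonal_change w B t LL).
apply: eq_bigr => k _; apply: eq_bigr => l _; exact: rhs.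
Qed.

(** The Leibniz rule, separating the derivative of the spinors from that of the
    curvature. *)
Lemma nabla_A_Fminus_act i c x k a : dom i c x ->
  nabla_A A S i c k (Fminus_act A S psi i c) x a =
  2^-1 *: \sum_m \sum_n ((nabla S c k (dx2_act c m n) x) a 0 *: F i c x m n
    + ((rho x)%:C *: dx2_act c m n x) a 0 *: cov (cn_form A i c) (F i c) x k m n).
Proof.
move=> xi; rewrite /nabla_A.
have -> : Fminus_act A S psi i c =
    fun z b => 2^-1 *: \sum_m \sum_n (dx2_act c m n z) b 0 *: F i c z m n.
  by apply/funext => z; apply/funext => b; exact: Fminus_actE.
have wd m n : mdiff (dx2_act c m n) x.
  apply: (@smooth_mx_mdiff _ setT) => //; apply: smooth_dx2_act; exact: openT.
have Fd m n : mdiff (fun z => F i c z m n) x by exact: smooth_mx_mdiff (smooth_curvature_dom i c m n) xi.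
have AE : \sum_m (frame k x 0 m)%:C *: cn_form A i c x m = (rho x)%:C *: cn_form A i c x k.
  rewrite -(sum_delta k (fun m => (rho x)%:C *: cn_form A i c x m)); apply: eq_bigr => m _.
  rewrite frameE !mxE eqxx /= scalerA; congr (_ *: _).
  by rewrite rmorphM rmorph_nat mulrC.
rewrite AE act_spin_sum.
have td m n b : mdiff (fun z => (dx2_act c m n z) b 0 *: F i c z m n) x.
  by apply: mdiffZ => //; exact: wd.
have -> : dir (frame k x) (fun z => 2^-1 *: \sum_m \sum_n (dx2_act c m n z) a 0 *: F i c z m n) x =
   2^-1 *: \sum_m \sum_n ((dir (frame k x) (dx2_act c m n) x) a 0 *: F i c x m n
     + (dx2_act c m n x) a 0 *: ((rho x)%:C *: partial k (fun z => F i c z m n) x)).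
  rewrite dirZ; last 2 first.
  - exact: cdiff_cst.
  - by apply: mdiff_sum => m; apply: mdiff_sum => n; exact: td.
  rewrite dirC_cst scale0r add0r; congr (_ *: _).
  rewrite dir_sum => [|m]; last by apply: mdiff_sum => n; exact: td.
  apply: eq_bigr => m _; rewrite dir_sum => [|n]; last exact: td.
  apply: eq_bigr => n _; rewrite (dirZ _ (wd m n a 0) (Fd m n)).
  rewrite {3}frameE (dir_scale _ _ (Fd m n)).
  by congr (_ *: _ + _); rewrite mxE.
have comm (t u : C) (B X : 'M[C]_r) :
    (t *: B) *m (u *: X) - (u *: X) *m (t *: B) = u *: (t *: (B *m X - X *m B)).
  by rewrite -!scalemxAl -!scalemxAr !scalerA [t * u]mulrC -scalerBr.
rewrite comm -!scalerDr; congr (_ *: _).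
rewrite mulmx_sumr mulmx_suml -sumrB scaler_sumr -!big_split; apply: eq_bigr => m _ /=.
rewrite mulmx_sumr mulmx_suml -sumrB scaler_sumr -!big_split; apply: eq_bigr => n _ /=.
have key (d w v t : C) (B D X : 'M[C]_r) :
    d *: X + w *: (t *: D) + v *: X + t *: (B *m (w *: X) - (w *: X) *m B) =
    (d + v) *: X + (t * w) *: (D + (B *m X - X *m B)).
  rewrite -scalemxAr -scalemxAl -scalerBr [_ + v *: X]addrAC -scalerDl -addrA !scalerA.
  by rewrite [w * t]mulrC -scalerDr.
rewrite key; congr (_ *: _ + _ *: _); last by rewrite [RHS]mxE.
by rewrite /nabla [RHS]mxE.
Qed.

Lemma dirac_Fminus_act i c x a : dom i c x ->
  dirac_A A S i c (Fminus_act A S psi i c) x a = 0.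
Proof.
move=> xi; have aS := cn_smooth_dom i c.
have Fd m n : mdiff (fun z => F i c z m n) x by exact: smooth_mx_mdiff (smooth_curvature_dom i c m n) xi.
rewrite /dirac_A.
pose T k m n := cov (cn_form A i c) (F i c) x k m n.
pose s k m n := gamma k *m nabla S c k (dx2_act c m n) x.
have E1 k : act_spin (gamma k) (nabla_A A S i c k (Fminus_act A S psi i c) x) a =
    2^-1 *: \sum_m \sum_n (s k m n) a 0 *: F i c x m n
    + 2^-1 *: \sum_m \sum_n ((rho x)%:C *: (gamma k *m dx2_act c m n x)) a 0 *: T k m n.
  have -> : nabla_A A S i c k (Fminus_act A S psi i c) x = fun b =>
     2^-1 *: \sum_m \sum_n (nabla S c k (dx2_act c m n) x) b 0 *: F i c x m n
     + 2^-1 *: \sum_m \sum_n ((rho x)%:C *: dx2_act c m n x) b 0 *: T k m n.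
    apply/funext => b; rewrite nabla_A_Fminus_act// -scalerDr; congr (_ *: _).
    by rewrite -big_split; apply: eq_bigr => m _; rewrite -big_split.
  have actD (M : 'M[C]_4) (P Q : end_spinor R r) :
     act_spin M (fun b => P b + Q b) a = act_spin M P a + act_spin M Q a.
    by rewrite /act_spin -big_split; apply: eq_bigr => b _; exact: scalerDr.
  rewrite actD !act_spin_sum; congr (_ + _); congr (_ *: _).
  by apply: eq_bigr => m _; apply: eq_bigr => n _; rewrite scalemxAr.
under eq_bigr do rewrite E1.
rewrite big_split /= -!scaler_sumr.
have -> : \sum_k \sum_m \sum_n (s k m n) a 0 *: F i c x m n = 0.
  rewrite exchange_big; apply: big1 => m _; rewrite exchange_big; apply: big1 => n _ /=.
  rewrite -scaler_suml; have [->|mn] := eqVneq m n; first by rewrite curvature_diag scaler0.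
  rewrite -summxE -[\sum_(i0 < 4) _]/(Defs.dirac S c (dx2_act c m n) x).
  rewrite (dirac_coord_2form mn _ (htwistor c x)) ?mxE ?scale0r//.
  exact: (@smooth_mx_mdiff _ setT _ _ _ _ (hpsi.1 c)).
have -> : \sum_k \sum_m \sum_n ((rho x)%:C *: (gamma k *m dx2_act c m n x)) a 0 *: T k m n =
   ((rho x)%:C * ((rho x)^+2)%:C) *:
     \sum_k \sum_m \sum_n (gamma k *m gamma m *m gamma n *m psi c x) a 0 *: T k m n.
  rewrite scaler_sumr; apply: eq_bigr => k _; rewrite scaler_sumr; apply: eq_bigr => m _.
  rewrite scaler_sumr; apply: eq_bigr => n _; rewrite scalerA; congr (_ *: _).
  by rewrite /dx2_act -scalemxAr scalerA mxE !mulmxA.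
rewrite clifford_cubic ?scaler0 ?addr0//.
- by move=> k m n; apply: cov_antisym => //; exact: curvatureA.
- by move=> k m n; exact: (bianchi k m n (@open_dom R r E i c) aS xi).
- by move=> m; exact: (yang_mills_divergence m Fd (fun k l n => hYM k l n xi)).
Qed.

End CurvatureAction.

Theorem proposition1 (R : realType) (S : spinor_bundle R) (r : nat)
    (E : vector_bundle R r) (A : connection E)
    (psi : bool -> 'rV[R]_4 -> 'cV[R[i]]_4)
    (hYM : yang_mills A) (hnsd : ~ self_dual A)
    (hpsi : spinor_section S psi)
    (hpsi_minus : forall c x, in_Sminus S (psi c x))
    (htwistor : forall c x k, twistor S c (psi c) x k = 0) :
  [/\ end_spinor_section S (Fminus_act A S psi),
      forall i c x, dom i c x -> in_Sminus_End S (Fminus_act A S psi i c x)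
    & forall i c x a, dom i c x ->
        dirac_A A S i c (Fminus_act A S psi i c) x a = 0].
Proof.
split.
- split=> [i c a|i j c x a|i x a].
  + exact: Fminus_act_smooth.
  + exact: Fminus_act_gauge.
  + exact: Fminus_act_trans.
- by move=> i c x _; exact: Fminus_act_minus.
- by move=> i c x a; exact: dirac_Fminus_act.
Qed.
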